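(* Let $1\le n\le N$. (i) If $\mathbf{X}=(X_1,\dots,X_n)$ is exchangeable and $N$-extendible, with values in $S^n$ for an arbitrary measurable space $S$, then its distribution $\mu_{\mathbf X}\in\mathcal P(S^n)$ has a representation $\mu_{\mathbf X}=\int_{\mathcal P(S)}\nu^n\,d\lambda(\nu)$ (meaning $\mu_{\mathbf X}(A)=\int\nu^n(A)\,d\lambda(\nu)$ for measurable $A\subseteq S^n$) with a signed measure $\lambda\in\mathcal M(\mathcal P(S))$ satisfying $\|\lambda\|_{\mathcal M(\mathcal P(S))}\le\kappa(n,N)$. The constant $\kappa(n,N)$ is in general best possible: there exist $S$ and such an $\mathbf X$ for which every representing $\lambda$ has $\|\lambda\|\ge\kappa(n,N)$. (ii) If furthermore $S$ is finite with $|S|=m$, then $\lambda$ can be chosen with $\|\lambda\|_{\mathcal M(\mathcal P(S))}\le\kappa(n,N;m):=\max_{\mathbf{x}\in S^N}\|\mu_{\mathbf{x}}\|_{\pi s+,\ell_1(S)}$. Moreover this constant is best possible for the given $S$ (it is the smallest $M$ such that every exchangeable $N$-extendible distribution on $S^n$ has such a representation with $\|\lambda\|\le M$). If $m\ge N$, then $\kappa(n,N;m)=\kappa(n,N)$.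
   Context: For a measurable space $S$, $\mathcal M(S)$ is the space of finite signed measures on $S$ with total variation norm, $\mathcal P(S)$ the probability measures; $\mathcal P(S)$ has the $\sigma$-field generated by $\mu\mapsto\mu(A)$, $A$ measurable, and $\mathcal M(\mathcal P(S))$ denotes finite signed measures on it; $\nu^n$ is the product measure. $(X_1,\dots,X_n)$ in $S^n$ is exchangeable if its distribution is invariant under coordinate permutations; it is $N$-extendible ($N\ge n$) if there is an exchangeable $(X_1,\dots,X_N)$ in $S^N$ whose first $n$ coordinates have the same distribution as $(X_1,\dots,X_n)$. For a finite set $S$, $\ell_1(S)$ is $\mathbb{R}^S$ with the $\ell_1$-norm, ordered coordinatewise; signed measures on $S^n$ are identified with elements of $\ell_1(S)^{\otimes n}$ via $\delta_{(s_1,\dots,s_n)}\leftrightarrow\delta_{s_1}\otimes\cdots\otimes\delta_{s_n}$, so exchangeable distributions are symmetric tensors in $\ell_1(S)^{\vee n}$. For a symmetric tensor $\mathbf{x}$, $\|\mathbf{x}\|_{\pi s+,\ell_1(S)}:=\inf\{\sum_k|a_k|\,\|x_k\|^n : \mathbf{x}=\sum_k a_k x_k^{\otimes n},\ x_k\in\ell_1(S),\ x_k\ge0\}$ (finite sums, $a_k\in\mathbb{R}$). $\chi_{n,N}$ is the distribution on $[N]^n$ ($[N]=\{1,\dots,N\}$) of $(Y_1,\dots,Y_n)$ where $(Y_1,\dots,Y_N)$ is a uniformly random permutation of $[N]$ (drawing $n$ elements without replacement), and $\kappa(n,N):=\|\chi_{n,N}\|_{\pi s+,\ell_1([N])}$.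 For finite $S$ and $\mathbf{x}=(x_1,\dots,x_N)\in S^N$, $\mu_{\mathbf x}$ is the distribution on $S^n$ of $(x_{Y_1},\dots,x_{Y_n})$, i.e. of $n$ draws without replacement from $x_1,\dots,x_N$. *)

(* Defs.v *)
From HB Require Import structures.
From mathcomp Require Import all_boot all_order all_algebra all_fingroup.
From mathcomp Require Import all_classical all_reals all_analysis.
Set Implicit Arguments. Unset Strict Implicit. Unset Printing Implicit Defensive.
Import Order.TTheory GRing.Theory Num.Theory.
Local Open Scope classical_set_scope.
Local Open Scope ring_scope.

(* ||T||_{pi s+, l1(S)} : inf of sum_k |a_k| ||x_k||_1^n over finite decompositions
   T = sum_k a_k x_k^{(x)n}, x_k >= 0 in l1(S).  A tensor on S^n is a function
   n.-tuple S -> R (the coefficient of delta_{s_1} (x) ... (x) delta_{s_n}). *)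
Definition pisnorm (R : realType) (S : finType) (n : nat) (T : n.-tuple S -> R) : R :=
  inf [set r : R | exists (k : nat) (a : 'I_k -> R) (x : 'I_k -> S -> R),
        [/\ forall i s, 0 <= x i s,
            forall t : n.-tuple S,
              T t = \sum_(i < k) a i * \prod_(j < n) x i (tnth t j)
          & r = \sum_(i < k) `|a i| * (\sum_(s : S) `|x i s|) ^+ n]].

(* chi_{n,N}: law of (Y_1,..,Y_n), (Y_1,..,Y_N) a uniform random permutation of [N] *)
Definition chi (R : realType) (n N : nat) (y : n.-tuple 'I_N) : R :=
  #|[set s : {perm 'I_N} | take n [seq s j | j <- enum 'I_N] == val y]|%:R
  / (N`!)%:R.

Definition kappa (R : realType) (n N : nat) : R := pisnorm (@chi R n N).

(* mu_x : law of n draws without replacement from x_1,..,x_N *)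
Definition mu_draw (R : realType) (S : finType) (n N : nat) (x : N.-tuple S)
  (y : n.-tuple S) : R :=
  #|[set s : {perm 'I_N} | take n [seq tnth x (s j) | j <- enum 'I_N] == val y]|%:R
  / (N`!)%:R.

Definition kappa_fin (R : realType) (S : finType) (n N : nat) : R :=
  \big[Num.max/0]_(x : N.-tuple S) pisnorm (@mu_draw R S n N x).

(* nu^n : n-fold product of a probability nu, on n.-tuple S with the product
   sigma-algebra (generated by the coordinates), defined recursively by
   nu^0 = dirac at the empty tuple, nu^{m+1}(A) = int nu^m(A_x) dnu(x), where
   A_x = {t | x :: t \in A}. *)
Fixpoint ppow d (S : measurableType d) (R : realType) (nu : probability S R)
  (n : nat) : set (n.-tuple S) -> \bar R :=
  match n return set (n.-tuple S) -> \bar R with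
  | 0 => fun A => \d_([tuple] : 0.-tuple S) A
  | m.+1 => fun A =>
      (\int[nu]_x @ppow d S R nu m [set t : m.-tuple S | A (cons_tuple x t)])%E
  end.
Arguments ppow {d S R} nu n _.

Definition exchangeable d (S : measurableType d) (R : realType) (n : nat)
  (mu : set (n.-tuple S) -> \bar R) : Prop :=
  forall (s : 'S_n) (A : set (n.-tuple S)), measurable A ->
    mu A = mu ((fun t : n.-tuple S => [tuple tnth t (s i) | i < n]) @^-1` A).

Definition extendible d (S : measurableType d) (R : realType) (n N : nat)
  (hnN : (n <= N)%N) (mu : set (n.-tuple S) -> \bar R) : Prop :=
  exists muN : probability (N.-tuple S) R,
    exchangeable muN /\
    forall A : set (n.-tuple S), measurable A ->
      mu A = muN ((fun t : N.-tuple S => [tuple tnth t (widen_ord hnN i) | i < n])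
                    @^-1` A).

Definition tvnorm d (T : measurableType d) (R : realType)
  (l : set T -> \bar R) : \bar R :=
  ereal_sup [set r : \bar R | exists (k : nat) (A : 'I_k -> set T),
     [/\ forall i, measurable (A i), trivIset setT A,
         \bigcup_(i in setT) A i = setT
       & r = (\sum_(i < k) `|l (A i)|)%E]].

(* mu = int nu^n dlambda(nu): with lambda = l1 - l2 (l1, l2 finite measures),
   mu(A) = int nu^n(A) dl1 - int nu^n(A) dl2 for every measurable A
   (the value does not depend on the chosen decomposition). *)
Definition represents d (S : measurableType d) (R : realType) (n : nat)
  (mu : set (n.-tuple S) -> \bar R)
  (l : {charge set (pprobability S R) -> \bar R}) : Prop :=
  exists l1 l2 : {finite_measure set (pprobability S R) -> \bar R},
    (forall B, measurable B -> l B = (l1 B - l2 B)%E) /\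
    forall A : set (n.-tuple S), measurable A ->
      mu A = ((\int[l1]_nu ppow nu n A) - (\int[l2]_nu ppow nu n A))%E.

Definition fdisc (S : finType) (s0 : S) : Type := S.
HB.instance Definition _ (S : finType) (s0 : S) := Finite.on (fdisc s0).
HB.instance Definition _ (S : finType) (s0 : S) := isPointed.Build (fdisc s0) s0.
Section fdisc_meas.
Variables (S : finType) (s0 : S).
Let m0 : [set: set (fdisc s0)] set0. Proof. by []. Qed.
Let mC : forall A, [set: set (fdisc s0)] A -> [set: set (fdisc s0)] (~` A).
Proof. by []. Qed.
Let mU : forall F : (set (fdisc s0))^nat, (forall i, [set: set (fdisc s0)] (F i)) ->
  [set: set (fdisc s0)] (\bigcup_i F i).
Proof. by []. Qed.
HB.instance Definition _ := @isMeasurable.Build default_measure_display (fdisc s0)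
  [set: set (fdisc s0)] m0 mC mU.
End fdisc_meas.

(* Main.v *)
Require Import Defs.
From HB Require Import structures.
From mathcomp Require Import all_boot all_order all_algebra all_fingroup.
From mathcomp Require Import all_classical all_reals all_analysis.
From mathcomp Require Import measurable_realfun interval_inference.
Set Implicit Arguments. Unset Strict Implicit. Unset Printing Implicit Defensive.
Import Order.TTheory GRing.Theory Num.Theory.
Import numFieldNormedType.Exports.
Local Open Scope classical_set_scope.
Local Open Scope ring_scope.

(** Normalising the vectors x_k, the norm ||T||_{pi s+} is the least l1-norm of
the coefficients in a decomposition of T as a signed mixture of powers p^{(x)n}
of probability vectors p.  By Caratheodory, #|S|^n terms suffice, so by
compactness the infimum is attained and the mixtures of norm at most M form a
closed set.

Upper bounds: averaging an N-extension of mu over all permutations of the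
coordinates gives mu(A) = E [sum_y chi(y) 1_A(X_{y_1},...,X_{y_n})].  Replacing
chi by an optimal mixture sum_k a_k p_k^{(x)n} and pushing the law of X forward
by X |-> sum_i p_k(i) delta_{X_i} gives lambda, with ||lambda|| <= sum_k |a_k|.
For finite S, mu is a convex combination of the mu_x, so its own norm is at most
kappa(n,N;m), and an optimal mixture for mu is the required lambda.

Lower bounds: for finite S, a representing lambda is approximated by finitely
many atoms, one in each cell of a fine partition of the simplex; closedness then
shows that the norm of mu is at most ||lambda||.  This applies to mu = mu_x, and
to mu = chi.  If |S| >= N, an injection of [N] into S maps chi to some mu_x and
has a left inverse, and neither map increases the norm. *)

(** * Signed mixtures of powers of probability vectors *)

Section tensor_mixtures.
Variables (R : realType) (n : nat).
Implicit Types S J : finType.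

Definition tensor_pow S (p : S -> R) (t : n.-tuple S) : R :=
  \prod_(j < n) p (tnth t j).

Definition prob_vec S (p : S -> R) : Prop :=
  (forall s, 0 <= p s) /\ \sum_s p s = 1.

(** Since [r] only bounds the l1-norm of the coefficients, the predicate is upward closed in [r],
    and bounds on [pisnorm] can be proved by exhibiting mixtures. *)
Definition mixture S (T : n.-tuple S -> R) (r : R) : Prop :=
  exists (k : nat) (a : 'I_k -> R) (p : 'I_k -> S -> R),
    [/\ forall i, prob_vec (p i),
        forall t, T t = \sum_i a i * tensor_pow (p i) t
      & \sum_i `|a i| <= r].

Lemma sum_enum_val J (F : J -> R) :
  \sum_i F i = \sum_(i < #|J|) F (enum_val i).
Proof.
rewrite (reindex (fun i : 'I_#|J| => enum_val i))//=; exact/onW_bij/enum_val_bij.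
Qed.

Lemma mixture_fin S J (a : J -> R) (p : J -> S -> R) (T : n.-tuple S -> R) r :
  (forall i, prob_vec (p i)) ->
  (forall t, T t = \sum_i a i * tensor_pow (p i) t) ->
  \sum_i `|a i| <= r -> mixture T r.
Proof.
move=> pp TE ar; exists #|J|, (a \o enum_val), (p \o enum_val); split => //=.
- by move=> t; rewrite TE sum_enum_val.
- by rewrite -(sum_enum_val (fun i => `|a i|)).
Qed.

Lemma mixture_ge0 S (T : n.-tuple S -> R) r : mixture T r -> 0 <= r.
Proof. by case=> k [a [p [_ _]]]; apply: le_trans; exact: sumr_ge0. Qed.

Lemma mixtureW S (T : n.-tuple S -> R) r r' : r <= r' -> mixture T r -> mixture T r'.
Proof. by move=> rr' [k [a [p [pp TE ar]]]]; exists k, a, p; split=> //; exact: le_trans rr'. Qed.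

Lemma eq_mixture S (T T' : n.-tuple S -> R) r :
  T =1 T' -> mixture T r -> mixture T' r.
Proof.
move=> TT' [k [a [p [pp TE ar]]]]; exists k, a, p; split=> // t.
by rewrite -TT'.
Qed.

Lemma mixture0 S : mixture (fun _ : n.-tuple S => 0) 0.
Proof.
exists 0, (fun=> 0), (fun _ _ => 0); split.
- by case.
- by move=> t; rewrite big_ord0.
- by rewrite big_ord0.
Qed.

Lemma mixtureD S (T T' : n.-tuple S -> R) r r' :
  mixture T r -> mixture T' r' -> mixture (T \+ T') (r + r').
Proof.
move=> [k [a [p [pp TE ar]]]] [k' [a' [p' [pp' TE' ar']]]].
pose J : finType := ('I_k + 'I_k')%type.
apply: (@mixture_fin _ J (fun i => match i with inl i => a i | inr i => a' i end)
          (fun i => match i with inl i => p i | inr i => p' i end)).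
- by case.
- by move=> t; rewrite big_sumType/= TE TE'.
- by rewrite big_sumType/= lerD.
Qed.

Lemma mixtureZ S (T : n.-tuple S -> R) r c :
  mixture T r -> mixture (fun t => c * T t) (`|c| * r).
Proof.
move=> [k [a [p [pp TE ar]]]]; exists k, (fun i => c * a i), p; split => //.
- by move=> t; rewrite TE mulr_sumr; apply: eq_bigr => i _; rewrite mulrA.
- under eq_bigr do rewrite normrM.
  by rewrite -mulr_sumr ler_wpM2l.
Qed.

Lemma mixture_sum S J (T : J -> n.-tuple S -> R) (r c : J -> R) (P : pred J) :
  (forall i, P i -> mixture (T i) (r i)) ->
  mixture (fun t => \sum_(i | P i) c i * T i t) (\sum_(i | P i) `|c i| * r i).
Proof.
move=> TP; elim: (index_enum J) => [|i s ih].
  rewrite big_nil; apply: eq_mixture (mixture0 S) => t.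
  by rewrite big_nil.
rewrite big_cons; case: ifPn => [Pi|nPi].
  apply: eq_mixture (mixtureD (mixtureZ (c i) (TP _ Pi)) ih) => t /=.
  by rewrite big_cons Pi.
by apply: eq_mixture ih => t; rewrite big_cons (negPf nPi).
Qed.

(** The pushforward of signed measures under [f] applied coordinatewise. *)
Definition tensor_push S S' (f : S -> S') (T : n.-tuple S -> R) (t : n.-tuple S') :=
  \sum_(y : n.-tuple S | map_tuple f y == t) T y.

(** Distributivity: expanding the product of the sums over the fibres of [f] gives one term for each
    tuple lying above [t]. *)
Lemma tensor_push_pow S S' (f : S -> S') (p : S -> R) t :
  tensor_push f (tensor_pow p) t =
  tensor_pow (fun s' => \sum_(s | f s == s') p s) t.
Proof.
rewrite /tensor_push /tensor_pow [RHS]bigA_distr_big_dep/=.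
rewrite (reindex (fun f : {ffun 'I_n -> S} => [tuple f i | i < n]))/=; last first.
  exists (fun t : n.-tuple S => [ffun i => tnth t i]) => x _.
    by apply/ffunP => i; rewrite ffunE tnth_mktuple.
  by apply: eq_from_tnth => i; rewrite tnth_mktuple ffunE.
apply: eq_big => [g|g _].
  apply/eqP/familyP => [<- i|gt].
    by rewrite unfold_in /= tnth_map tnth_mktuple.
  apply: eq_from_tnth => i; rewrite tnth_map tnth_mktuple.
  by have := gt i; rewrite unfold_in => /eqP.
by apply: eq_bigr => i _; rewrite tnth_mktuple.
Qed.

(** Only the probability vectors are pushed forward; the coefficients stay the same. *)
Lemma mixture_push S S' (f : S -> S') (T : n.-tuple S -> R) r :
  mixture T r -> mixture (tensor_push f T) r.
Proof.
move=> [k [a [p [pp TE ar]]]].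
exists k, a, (fun i s' => \sum_(s | f s == s') p i s); split => //.
- move=> i; have [p0 p1] := pp i; split => [s|]; first exact: sumr_ge0.
  rewrite -[RHS]p1 [RHS](partition_big f predT)//=.
- move=> t; rewrite /tensor_push; under eq_bigr do rewrite TE.
  rewrite exchange_big/=; apply: eq_bigr => i _.
  by rewrite -mulr_sumr -tensor_push_pow.
Qed.

(* Caratheodory: a linear relation among more than [#|n.-tuple S|] powers lets
   one move the coefficients, without increasing their l1-norm, until one of
   them vanishes. *)
Lemma mixture_reduce S k (a : 'I_k -> R) (p : 'I_k -> S -> R) :
  (#|{: n.-tuple S}| < k)%N ->
  exists (i0 : 'I_k) (a' : 'I_k -> R), [/\ a' i0 = 0,
    forall t, \sum_i a' i * tensor_pow (p i) t = \sum_i a i * tensor_pow (p i) t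
    & \sum_i `|a' i| <= \sum_i `|a i|].
Proof.
move=> Dk.
have [[i ai0]|a0] := pselect (exists i, a i = 0); first by exists i, a.
have {}a0 i : a i != 0 by apply/eqP => ai0; apply: a0; exists i.
pose A : 'M[R]_(k, #|{: n.-tuple S}|) := \matrix_(i, j) tensor_pow (p i) (enum_val j).
have /rowV0Pn[b bA b0] : kermx A != 0.
  by rewrite kermx_eq0 -row_leq_rank -ltnNge (leq_ltn_trans (rank_leq_col _)).
have brel t : \sum_i b 0 i * tensor_pow (p i) t = 0.
  have /matrixP/(_ 0 (enum_rank t)) : b *m A = 0 by apply/sub_kermxP.
  rewrite !mxE => bE; rewrite -[RHS]bE; apply: eq_bigr => i _.
  by rewrite mxE enum_rankK.
(* Until some coefficient changes sign, moving from [a] to [a - t b'] lowers the l1-norm by [t]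
   times the last sum, so the sign of the relation is chosen to make that sum nonnegative. *)
have [b' [b'0 b'rel b'pos]] : exists b' : 'I_k -> R, [/\ exists i, b' i != 0,
    forall t, \sum_i b' i * tensor_pow (p i) t = 0 &
    0 <= \sum_i `|a i| * (b' i / a i)].
  have [i bi0] : exists i, b 0 i != 0.
    apply/existsP; rewrite -negb_forall; apply: contra b0 => /forallP b0.
    by apply/eqP/rowP => i; rewrite mxE; exact/eqP.
  have [pos|/ltW neg] := leP 0 (\sum_i `|a i| * (b 0 i / a i)).
    by exists (b 0); split => //; exists i.
  exists (fun i => - b 0 i); split.
  - by exists i; rewrite oppr_eq0.
  - by move=> t; under eq_bigr do rewrite mulNr; rewrite sumrN brel oppr0.
  - under eq_bigr do rewrite mulNr mulrN.
    by rewrite sumrN oppr_ge0.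
pose c i := b' i / a i.
(* If no ratio were positive, every term of the nonnegative sum would vanish, and [b'] with them. *)
have [i1 ci1] : exists i, 0 < c i.
  have [//|nc] := pselect (exists i, 0 < c i); exfalso.
  have {}nc i : c i <= 0 by rewrite leNgt; apply/negP => ci; apply: nc; exists i.
  have t0 i : true -> 0 <= - (`|a i| * c i) by rewrite oppr_ge0 mulr_ge0_le0.
  have : \sum_i - (`|a i| * c i) = 0.
    apply/eqP; rewrite eq_le sumr_ge0// andbT sumrN oppr_le0; exact: b'pos.
  move/psumr_eq0P => /(_ t0) z.
  case: b'0 => i; apply/negP; rewrite negbK.
  have /eqP := z i isT; rewrite oppr_eq0 mulf_eq0 normr_eq0 (negPf (a0 i))/=.
  by rewrite mulf_eq0 invr_eq0 (negPf (a0 i)) orbF.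
have [i0 cmax] : exists i0, forall i, c i <= c i0.
  by case: (arg_maxP c (isT : xpredT i1)) => i0 _ cmax; exists i0 => i; exact: cmax.
have ci0 : 0 < c i0 by apply: lt_le_trans ci1 _; exact: cmax.
(* The time [t = 1 / c i0] is the first at which a coefficient vanishes; maximality of [c i0] keeps
   all the factors nonnegative. *)
exists i0, (fun i => a i * (1 - c i / c i0)); split.
- by rewrite divff ?gt_eqF// subrr mulr0.
- move=> t; under eq_bigr do rewrite mulrBr mulr1 mulrBl.
  rewrite sumrB [X in _ - X](_ : _ = 0) ?subr0//.
  transitivity ((c i0)^-1 * \sum_i b' i * tensor_pow (p i) t); last by rewrite b'rel mulr0.
  rewrite mulr_sumr; apply: eq_bigr => i _.
  have -> : a i * (c i / c i0) = (c i0)^-1 * b' i.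
    by rewrite mulrA [a i * _]mulrC [c i * _]divfK// mulrC.
  by rewrite mulrA.
- have c1 i : 0 <= 1 - c i / c i0.
    by rewrite subr_ge0 ler_pdivrMr// mul1r; exact: cmax.
  under eq_bigr do rewrite normrM (ger0_norm (c1 _)) mulrBr mulr1.
  rewrite sumrB lerBlDr lerDl.
  under eq_bigr do rewrite mulrA.
  by rewrite -mulr_suml divr_ge0// ltW.
Qed.

Lemma mixture_pad S (s0 : S) k D (a : 'I_k -> R) (p : 'I_k -> S -> R) :
  (k <= D)%N -> (forall i, prob_vec (p i)) ->
  exists (a' : 'I_D -> R) (p' : 'I_D -> S -> R),
    [/\ forall i, prob_vec (p' i),
        forall t, \sum_i a' i * tensor_pow (p' i) t = \sum_i a i * tensor_pow (p i) t
      & \sum_i `|a' i| = \sum_i `|a i|].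
Proof.
move=> kD pp.
(* The added terms have coefficient 0 and the point mass at [s0], so that every vector is still a
   probability vector. *)
pose a' (i : 'I_D) := if insub (val i) is Some j then a j else 0.
pose p' (i : 'I_D) := if insub (val i) is Some j then p j else fun s => (s == s0)%:R.
have E (F : 'I_D -> R) (G : 'I_k -> R) :
    (forall i, F (widen_ord kD i) = G i) ->
    (forall i : 'I_D, (k <= i)%N -> F i = 0) -> \sum_i F i = \sum_i G i.
  move=> FG F0; under [RHS]eq_bigr do rewrite -FG.
  rewrite (bigID (fun i : 'I_D => (i < k)%N))/= [X in _ + X]big1 ?addr0; last first.
    by move=> i; rewrite -leqNgt => /F0.
  by rewrite (big_ord_narrow kD).
have insubE (i : 'I_k) : insub (val (widen_ord kD i)) = Some i.
  exact: (@valK _ _ 'I_k).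
exists a', p'; split.
- move=> i; rewrite /p'; case: insubP => [j _ _//|_]; split => [s|].
    by rewrite ler0n.
  by rewrite (bigD1 s0)//= eqxx big1 ?addr0// => s /negPf ->.
- move=> t; apply: E => i; first by rewrite /a' /p' insubE.
  by move=> ki; rewrite /a' insubF ?mul0r// ltnNge ki.
- apply: E => i; first by rewrite /a' insubE.
  by move=> ki; rewrite /a' insubF ?normr0// ltnNge ki.
Qed.

(** A fixed number of terms puts all decompositions in one finite-dimensional space, where
    compactness is available. The induction is on the number of terms: a short decomposition is
    padded, a long one loses its vanishing term. *)
Lemma mixture_caratheodory S (s0 : S) (T : n.-tuple S -> R) r : mixture T r ->
  exists (a : 'I_#|{: n.-tuple S}| -> R) (p : 'I_#|{: n.-tuple S}| -> S -> R),
    [/\ forall i, prob_vec (p i),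
        forall t, T t = \sum_i a i * tensor_pow (p i) t
      & \sum_i `|a i| <= r].
Proof.
set D := #|_|; case=> k; elim: k => [|k ih] [a [p [pp TE ar]]].
  have [a' [p' [pp' TE' ar']]] := mixture_pad s0 a (leq0n D) pp; exists a', p'.
  by split => [//|t|]; rewrite ?TE'// ar'.
have [kD|Dk] := leqP k.+1 D.
  have [a' [p' [pp' TE' ar']]] := mixture_pad s0 a kD pp; exists a', p'.
  by split => [//|t|]; rewrite ?TE'// ar'.
have [i0 [a' [a'0 a'T a'r]]] := mixture_reduce a p Dk.
apply: ih; exists (fun i => a' (lift i0 i)), (fun i => p (lift i0 i)); split => //.
- by move=> t; rewrite TE -a'T (bigD1_ord i0)//= a'0 mul0r add0r.
- by apply: le_trans ar; apply: le_trans a'r; rewrite (bigD1_ord i0)//= a'0 normr0 add0r.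
Qed.

Lemma continuous_normr (X : topologicalType) (f : X -> R) :
  continuous f -> continuous (fun x => `|f x|).
Proof. by move=> cf x; apply: cvg_norm; exact: cf. Qed.

Lemma continuous_addr (X : topologicalType) (f g : X -> R) :
  continuous f -> continuous g -> continuous (fun x => f x + g x).
Proof. by move=> cf cg x; apply: cvgD; [exact: cf|exact: cg]. Qed.

Lemma continuous_mulr (X : topologicalType) (f g : X -> R) :
  continuous f -> continuous g -> continuous (fun x => f x * g x).
Proof. by move=> cf cg x; apply: cvgM; [exact: cf|exact: cg]. Qed.

Lemma continuous_oppr (X : topologicalType) (f : X -> R) :
  continuous f -> continuous (fun x => - f x).
Proof. by move=> cf x; apply: cvgN; exact: cf. Qed.

Lemma continuous_maxr (X : topologicalType) (f g : X -> R) :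
  continuous f -> continuous g -> continuous (fun x => Num.max (f x) (g x)).
Proof. by move=> cf cg x; apply: continuous_max; [exact: cf|exact: cg]. Qed.

Lemma continuous_bigr (X : topologicalType) J (F : J -> X -> R)
    (op : R -> R -> R) (idx : R) :
  (forall f g : X -> R, continuous f -> continuous g ->
    continuous (fun x => op (f x) (g x))) ->
  (forall i, continuous (F i)) -> continuous (fun x => \big[op/idx]_i F i x).
Proof.
move=> cop cF; elim: (index_enum J) => [|i s ih].
  by rewrite [X in continuous X](_ : _ = cst idx); [exact: cst_continuous|
    apply/funext => x; rewrite big_nil].
rewrite [X in continuous X](_ : _ = fun x => op (F i x) (\big[op/idx]_(j <- s) F j x)).
  exact: cop.
by apply/funext => x; rewrite big_cons.
Qed.

Lemma continuous_sumr (X : topologicalType) J (F : J -> X -> R) :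
  (forall i, continuous (F i)) -> continuous (fun x => \sum_i F i x).
Proof.
by apply: continuous_bigr; exact: continuous_addr.
Qed.

Lemma continuous_prodr (X : topologicalType) J (F : J -> X -> R) :
  (forall i, continuous (F i)) -> continuous (fun x => \prod_i F i x).
Proof.
by apply: continuous_bigr; exact: continuous_mulr.
Qed.

(** The continuous defect [h] attains its minimum on a compact box of coefficients and vectors. The
    approximations force this minimum to be 0, and a zero of [h] in the box is a decomposition of
    [T] of norm at most [M]. *)
Lemma mixture_closed S (s0 : S) (T : n.-tuple S -> R) M :
  (forall e : R, 0 < e -> exists T', mixture T' (M + e) /\
    forall t, `|T t - T' t| <= e) -> mixture T M.
Proof.
move=> Tapp; set D := #|{: n.-tuple S}|.
(* At index [i], the slot [None] holds the coefficient and the slot [Some s] the entry at [s] of the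
   vector. *)
pose J : finType := ('I_D * option S)%type.
pose X : topologicalType := prod_topology (fun _ : J => R : topologicalType).
pose h (f : X) : R :=
  \sum_t `|T t - \sum_i f (i, None) * tensor_pow (fun s => f (i, Some s)) t|
  + \sum_i `|\sum_s f (i, Some s) - 1|
  + Num.max 0 (\sum_i `|f (i, None)| - M).
(* The bound [M + 1] suffices because only errors [e <= 1] are used. *)
pose box (j : J) : set R := if j.2 is Some _ then `[0, 1]%classic else `[- (M + 1), M + 1]%classic.
pose A : set X := [set f | forall j, box j (f j)].
have cA : compact A.
  by apply: tychonoff => -[i [s|]]; exact: segment_compact.
have ch : continuous h.
  have cpr j : continuous (fun f : X => f j).
    exact: (@proj_continuous _ (fun _ : J => R : topologicalType) j).
  have ccst (c : R) : continuous (fun _ : X => c) by exact: cst_continuous.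
  apply: continuous_addr; first apply: continuous_addr.
  - apply: continuous_sumr => t; apply: continuous_normr; apply: continuous_addr => //.
    apply: continuous_oppr; apply: continuous_sumr => i; apply: continuous_mulr => //.
    by apply: continuous_prodr => j; exact: cpr.
  - apply: continuous_sumr => i; apply: continuous_normr; apply: continuous_addr => //.
    by apply: continuous_sumr => s; exact: cpr.
  - apply: continuous_maxr => //; apply: continuous_addr => //.
    by apply: continuous_sumr => i; exact: continuous_normr.
have hsmall e : 0 < e -> e <= 1 -> exists2 f, A f & h f <= e *+ D + e.
  move=> e0 e1; have [T' [mT' TT']] := Tapp e e0.
  have [a [p [pp T'E ar]]] := mixture_caratheodory s0 mT'.
  exists (fun j => if j.2 is Some s then p j.1 s else a j.1).
    move=> [i [s|]]; rewrite /box/= in_itv/=.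
      have [p0 p1] := pp i; rewrite p0/= -p1 (bigD1 s)//= lerDl.
      exact: sumr_ge0.
    rewrite -ler_norml; apply: (@le_trans _ _ (M + e)); last by rewrite lerD2l.
    by apply: le_trans ar; rewrite (bigD1 i)//= lerDl; exact: sumr_ge0.
  rewrite /h/= [X in _ + X + _]big1 ?addr0; last first.
    by move=> i _; have [_ ->] := pp i; rewrite subrr normr0.
  apply: lerD; last by rewrite ge_max ltW//= lerBlDl.
  apply: (@le_trans _ _ (\sum_(t : n.-tuple S) e)).
    by apply: ler_sum => t _; rewrite -T'E.
  by rewrite sumr_const.
have [f0 Af0 _] := hsmall 1 ltr01 (lexx _).
have [f /set_mem Af fmin] : exists2 c, c \in A & forall t, t \in A -> h c <= h t.
  by apply: compact_EVT_min cA _; [exists f0|exact: continuous_subspaceT].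
have hf0 : h f <= 0.
  apply/ler_addgt0Pl => e e0; rewrite addr0.
  (* With this [d] the total defect, [d] for each of the [D] entries and [d] for the norm, is at
     most [e]. *)
  pose d := Num.min 1 (e / D.+1%:R).
  have d0 : 0 < d by rewrite lt_min ltr01 divr_gt0.
  have d1 : d <= 1 by rewrite ge_min lexx.
  have [g Ag hg] := hsmall d d0 d1.
  apply: le_trans (fmin g (mem_set Ag)) _; apply: le_trans hg _.
  rewrite -mulrSr -mulr_natr -ler_pdivlMr//.
  by rewrite ge_min lexx orbT.
have h1 : 0 <= \sum_t `|T t - \sum_i f (i, None) * tensor_pow (fun s => f (i, Some s)) t|.
  exact: sumr_ge0.
have h2 : 0 <= \sum_i `|\sum_s f (i, Some s) - 1| by exact: sumr_ge0.
have h3 : 0 <= Num.max 0 (\sum_i `|f (i, None)| - M) by rewrite le_max lexx.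
move: hf0; rewrite /h => hf0.
have h12 := addr_ge0 h1 h2.
have h123 : h f == 0 by rewrite eq_le hf0 /h addr_ge0.
move: h123; rewrite /h paddr_eq0// paddr_eq0// => /andP[/andP[/eqP e1 /eqP e2] /eqP e3].
exists D, (fun i => f (i, None)), (fun i s => f (i, Some s)); split.
- move=> i; split => [s|].
    by have := Af (i, Some s); rewrite /box/= in_itv/= => /andP[].
  have /psumr_eq0P := e2; move=> /(_ (fun i _ => normr_ge0 _) i isT) /eqP.
  by rewrite normr_eq0 subr_eq0 => /eqP.
- move=> t; have /psumr_eq0P := e1; move=> /(_ (fun t _ => normr_ge0 _) t isT) /eqP.
  by rewrite normr_eq0 subr_eq0 => /eqP.
- by rewrite -subr_le0 -[leRHS]e3 le_max lexx orbT.
Qed.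

End tensor_mixtures.

(** * The projective norm as the least bound of a mixture *)

Section pisnorm_mixture.
Variables (R : realType) (n : nat).
Implicit Types S : finType.

Lemma pisnorm_lb S (T : n.-tuple S -> R) :
  has_lbound [set r : R | exists (k : nat) (a : 'I_k -> R) (x : 'I_k -> S -> R),
        [/\ forall i s, 0 <= x i s,
            forall t : n.-tuple S,
              T t = \sum_(i < k) a i * \prod_(j < n) x i (tnth t j)
          & r = \sum_(i < k) `|a i| * (\sum_(s : S) `|x i s|) ^+ n]].
Proof.
exists 0 => _ [k [a [x [_ _ ->]]]]; apply: sumr_ge0 => i _.
by rewrite mulr_ge0// exprn_ge0// sumr_ge0.
Qed.

Lemma mixture_decomposition S (T : n.-tuple S -> R) r : mixture T r ->
  exists2 r', r' <= r & exists (k : nat) (a : 'I_k -> R) (x : 'I_k -> S -> R),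
        [/\ forall i s, 0 <= x i s,
            forall t : n.-tuple S,
              T t = \sum_(i < k) a i * \prod_(j < n) x i (tnth t j)
          & r' = \sum_(i < k) `|a i| * (\sum_(s : S) `|x i s|) ^+ n].
Proof.
move=> [k [a [p [pp TE ar]]]]; exists (\sum_i `|a i|) => //.
exists k, a, p; split => //; first by move=> i; case: (pp i).
apply: eq_bigr => i _; have [p0 p1] := pp i.
by under [in RHS]eq_bigr do rewrite (ger0_norm (p0 _)); rewrite p1 expr1n mulr1.
Qed.

Lemma pisnorm_le S (T : n.-tuple S -> R) r : mixture T r -> pisnorm T <= r.
Proof.
move=> /mixture_decomposition[r' r'r Tr']; apply: le_trans r'r.
by apply: ge_inf => //; exact: pisnorm_lb.
Qed.

(** Each vector is divided by its mass, whose [n]-th power goes into the coefficient. A zero vector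
    is replaced by the point mass at [s0]; as [0 < n], its coefficient becomes 0 and its power was
    already 0. *)
Lemma decomposition_mixture S (s0 : S) (T : n.-tuple S -> R) k
    (a : 'I_k -> R) (x : 'I_k -> S -> R) : (0 < n)%N ->
  (forall i s, 0 <= x i s) ->
  (forall t, T t = \sum_(i < k) a i * \prod_(j < n) x i (tnth t j)) ->
  mixture T (\sum_(i < k) `|a i| * (\sum_(s : S) `|x i s|) ^+ n).
Proof.
move=> n0 x0 TE; pose m i := \sum_s x i s.
have mE i : \sum_s `|x i s| = m i by apply: eq_bigr => s _; rewrite ger0_norm.
have m0 i : 0 <= m i by exact: sumr_ge0.
exists k, (fun i => a i * m i ^+ n),
  (fun i s => if m i == 0 then (s == s0)%:R else x i s / m i); split.
- move=> i; case: (eqVneq (m i) 0) => [_|mi0]; split => [s|].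
  + by rewrite ler0n.
  + by rewrite (bigD1 s0)//= eqxx big1 ?addr0// => s /negPf ->.
  + by rewrite divr_ge0.
  + by rewrite -mulr_suml divff.
- move=> t; rewrite TE; apply: eq_bigr => i _; rewrite -mulrA; congr (_ * _).
  rewrite /tensor_pow; case: (eqVneq (m i) 0) => [mi0|mi0].
    rewrite mi0 expr0n gtn_eqF// mul0r.
    have /psumr_eq0P xz := mi0.
    by rewrite (bigD1 (Ordinal n0))//= xz ?mul0r.
  rewrite big_split/= prodr_const card_ord exprVn mulrCA divff ?mulr1//.
  by rewrite expf_eq0 (negPf mi0) andbF.
- by apply: ler_sum => i _; rewrite mE normrM (ger0_norm (exprn_ge0 _ (m0 i))).
Qed.

(** The infimum is attained, by closedness applied to near-optimal decompositions of [T] itself. The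
    given mixture ensures that the infimum is taken over a nonempty set. *)
Lemma mixture_pisnorm S (s0 : S) (T : n.-tuple S -> R) r : (0 < n)%N ->
  mixture T r -> mixture T (pisnorm T).
Proof.
move=> n0 Tr; apply: (mixture_closed s0) => e e0; exists T; split; last first.
  by move=> t; rewrite subrr normr0 ltW.
have [|_ [k [a [x [x0 TE ->]]]] /ltW re] := inf_adherent e0 (_ : has_inf [set r : R |
    exists (k : nat) (a : 'I_k -> R) (x : 'I_k -> S -> R),
        [/\ forall i s, 0 <= x i s,
            forall t : n.-tuple S,
              T t = \sum_(i < k) a i * \prod_(j < n) x i (tnth t j)
          & r = \sum_(i < k) `|a i| * (\sum_(s : S) `|x i s|) ^+ n]]).
  split; last exact: pisnorm_lb.
  by have [r' _ Tr'] := mixture_decomposition Tr; exists r'.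
by apply: mixtureW re _; exact: decomposition_mixture.
Qed.

(* By inclusion-exclusion on the image, from the tensors [t |-> [t \subset I]]
   which are multiples of powers of uniform distributions. *)
Lemma mixture_image S (I : {set S}) : (0 < n)%N ->
  exists r, mixture (fun t : n.-tuple S => ([set s in t]%SET == I)%:R : R) r.
Proof.
move=> n0; have [m] := ubnP #|I|; elim: m I => // m ih I Im.
have [I0|I0] := eqVneq I finset.set0.
  exists 0; apply: eq_mixture (mixture0 R n S) => t.
  have /negPf -> // : [set s in t]%SET != I.
  by rewrite I0; apply/set0Pn; exists (tnth t (Ordinal n0)); rewrite inE mem_tnth.
have cI0 : #|I|%:R != 0 :> R by rewrite pnatr_eq0 cards_eq0.
(* The power of the uniform vector on [I] is [#|I|^-n] on the tuples with entries in [I] and 0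
   elsewhere. *)
have subI : mixture (fun t : n.-tuple S => ([set s in t]%SET \subset I)%:R : R)
    (#|I|%:R ^+ n).
  exists 1, (fun=> #|I|%:R ^+ n), (fun _ s => (s \in I)%:R / #|I|%:R); split.
  - move=> _; split => [s|]; first by rewrite divr_ge0.
    rewrite -mulr_suml (_ : \sum_s _ = #|I|%:R) ?divff//.
    rewrite -sum1_card natr_sum [RHS]big_mkcond/=; apply: eq_bigr => s _.
    by case: (s \in I).
  - move=> t; rewrite big_ord1 /tensor_pow big_split/= prodr_const card_ord exprVn.
    rewrite mulrCA divff ?mulr1; last by rewrite expf_eq0 (negPf cI0) andbF.
    case: (boolP (_ \subset _)) => [/fintype.subsetP tI|].
      by rewrite big1// => i _; rewrite tI// inE mem_tnth.
    move=> /fintype.subsetPn[s]; rewrite inE => /tnthP[i ->] /negPf tI.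
    by rewrite (bigD1 i)//= tI mul0r.
  - by rewrite big_ord1 ger0_norm// exprn_ge0.
have /choice[r hr] : forall J : {set S}, exists r,
    J \proper I -> mixture (fun t : n.-tuple S => ([set s in t]%SET == J)%:R : R) r.
  move=> J; have [JI|nJI] := boolP (J \proper I); last by exists 0.
  have [r hr] := ih J (leq_trans (proper_card JI) Im); by exists r.
(* From the tuples with image inside [I], those with a proper subset of [I] as image are
   subtracted. *)
have := mixtureD subI (mixtureZ (-1) (mixture_sum (fun=> 1) hr)).
set r' := (X in mixture _ X) => h; exists r'; apply: eq_mixture h => t /=.
rewrite mulN1r; under eq_bigr do rewrite mul1r.
set It := [set s in t]%SET.
have [->|ItI] := eqVneq It I.
  rewrite fintype.subxx big1 ?subr0// => J /properP[_ [s sI sJ]].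
  by case: eqP => // IJ; rewrite -IJ sI in sJ.
have [sItI|nItI] := boolP (It \subset I).
  rewrite (bigD1 It)/=; last by rewrite finset.properEneq ItI.
  by rewrite eqxx big1 ?addr0 ?subrr// => J /andP[_ /negPf]; rewrite eq_sym => ->.
rewrite big1 ?subrr// => J /proper_sub JI.
by case: eqP => // IJ; rewrite IJ JI in nItI.
Qed.

End pisnorm_mixture.

(** * Draws without replacement *)

Section draws.
Variables (R : realType) (n N : nat).
Hypothesis hnN : (n <= N)%N.

Definition draw (s : 'S_N) : n.-tuple 'I_N := [tuple s (widen_ord hnN i) | i < n].

Lemma take_drawE (S : eqType) (x : N.-tuple S) (s : 'S_N) :
  take n [seq tnth x (s j) | j <- enum 'I_N] = map_tuple (tnth x) (draw s).
Proof.
rewrite /= -map_comp -map_take.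
have -> : take n (enum 'I_N) = [seq widen_ord hnN i | i <- enum 'I_n].
  apply: (inj_map val_inj); rewrite map_take val_enum_ord -map_comp.
  rewrite (_ : _ \o _ = val)// val_enum_ord take_iota.
  by rewrite (minn_idPl hnN).
by rewrite -map_comp.
Qed.

Lemma mu_drawE (S : finType) (x : N.-tuple S) (y : n.-tuple S) :
  mu_draw R x y =
  (N`!)%:R^-1 * \sum_(s : 'S_N) (map_tuple (tnth x) (draw s) == y)%:R.
Proof.
rewrite /mu_draw mulrC -natr_sum; congr (_ * _%:R).
rewrite -sum1_card [RHS]big_mkcond [LHS]big_mkcond/=; apply: eq_bigr => s _.
rewrite -[in RHS]val_eqE/= -take_drawE; case: (boolP (_ == _)) => [e|ne].
  by rewrite mem_set.
by rewrite memNset//; exact/negP.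
Qed.

Lemma chiE (y : n.-tuple 'I_N) :
  chi R y = (N`!)%:R^-1 * \sum_(s : 'S_N) (draw s == y)%:R.
Proof.
transitivity (mu_draw R (ord_tuple N) y).
  rewrite /chi /mu_draw; congr (#|_|%:R / _).
  have E (s : 'S_N) : [seq tnth (ord_tuple N) (s j) | j <- enum 'I_N] =
      [seq s j | j <- enum 'I_N] by apply: eq_map => j; rewrite tnth_ord_tuple.
  by apply/seteqP; split => s /=; rewrite E.
rewrite mu_drawE; congr (_ * _); apply: eq_bigr => s _; congr (_ == _)%:R.
by apply: eq_from_tnth => i; rewrite tnth_map tnth_ord_tuple.
Qed.

(** Drawing from [x] means drawing positions and then reading [x] there; this transports mixtures of
    [chi] to all [mu_draw R x]. *)
Lemma mu_draw_push (S : finType) (x : N.-tuple S) :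
  mu_draw R x =1 tensor_push (tnth x) (@chi R n N).
Proof.
move=> y; rewrite mu_drawE /tensor_push; under [RHS]eq_bigr do rewrite chiE.
rewrite -mulr_sumr exchange_big/=; congr (_ * _); apply: eq_bigr => s _.
rewrite big_mkcond/= (bigD1 (draw s))//= eqxx big1 ?addr0.
  by case: eqP.
by move=> z; rewrite eq_sym => /negPf ->; case: ifP.
Qed.

Lemma draw_onto (y : n.-tuple 'I_N) : uniq y -> exists s, draw s = y.
Proof.
(* Appending the indices missing from [y] gives an enumeration of [N], hence a permutation. *)
move=> uy; pose z := y ++ [seq i <- enum 'I_N | i \notin y].
have : perm_eq z (ord_tuple N).
  apply: uniq_perm => [||i].
  - rewrite cat_uniq uy/= filter_uniq ?enum_uniq// andbT.
    by apply/hasPn => i; rewrite mem_filter => /andP[].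
  - exact: enum_uniq.
  - have mi : i \in enum 'I_N by rewrite mem_enum.
    by rewrite mem_cat mem_filter mi andbT orbN.
move=> /tuple_permP[s zs]; exists s; apply: eq_from_tnth => i.
rewrite tnth_mktuple.
have := congr1 (fun z => nth (s (widen_ord hnN i)) z i) zs.
rewrite /z nth_cat size_tuple ltn_ord -tnth_nth => ->.
rewrite -(tnth_nth _ _ (widen_ord hnN i)) tnth_mktuple.
by rewrite tnth_ord_tuple.
Qed.

Lemma uniq_draw s : uniq (draw s).
Proof.
rewrite map_inj_uniq ?enum_uniq// => i j /perm_inj /(congr1 val) /= ij.
exact: val_inj.
Qed.

(** The permutation [g] carries [y] to [z], and right multiplication by [g] matches the permutations
    counted on both sides. *)
Lemma chi_uniq (y z : n.-tuple 'I_N) : uniq y -> uniq z -> chi R y = chi R z.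
Proof.
move=> /draw_onto[s sy] /draw_onto[s' s'z].
pose g := (s^-1 * s')%g.
rewrite !chiE; congr (_ * _).
rewrite [RHS](reindex_inj (mulIg g))/=; apply: eq_bigr => u _; congr _%:R.
have E v : draw (v * g)%g = map_tuple g (draw v).
  by apply: eq_from_tnth => i; rewrite [RHS]tnth_map !tnth_mktuple permM.
have -> : z = map_tuple g y by rewrite -s'z -sy -E /g mulKVg.
by rewrite E -[in RHS]val_eqE/= (inj_eq (inj_map perm_inj)).
Qed.

(** As [chi] is constant on injective tuples and 0 elsewhere, it is a multiple of the sum, over the
    [n]-element sets [I], of the indicators of image [I]. So some mixture exists, and the optimal
    one is attained. *)
Lemma chi_mixture : (0 < n)%N -> mixture (@chi R n N) (kappa R n N).
Proof.
move=> n0; suff [r] : exists r, mixture (@chi R n N) r.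
  by apply: mixture_pisnorm => //; exact: Ordinal (leq_trans n0 hnN).
pose y0 := draw 1%g.
have /choice[r hr] := fun I : {set 'I_N} => @mixture_image R n _ I n0.
have := mixture_sum (fun=> chi R y0) (fun (I : {set 'I_N}) (_ : #|I| == n) => hr I).
set r' := (X in mixture _ X) => h; exists r'; apply: eq_mixture h => y /=.
rewrite -mulr_sumr.
have cardE : #|[set i in y]%SET| = #|y| by apply: eq_card => i; rewrite inE.
have [uy|nuy] := boolP (uniq y).
  rewrite (bigD1 [set i in y]%SET)/=; last by rewrite cardE (card_uniqP uy) size_tuple.
  rewrite eqxx big1 ?addr0 ?mulr1; last by move=> I /andP[_ /negPf]; rewrite eq_sym => ->.
  by apply: chi_uniq => //; exact: uniq_draw.
rewrite big1 ?mulr0; last first.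
  move=> I In; case: eqP => // yI; case/negP: nuy; apply/card_uniqP.
  by rewrite -cardE yI size_tuple; exact/eqP.
rewrite chiE big1 ?mulr0// => s _; case: eqP => // sy.
by rewrite -sy uniq_draw in nuy.
Qed.

Lemma mu_draw_mixture (S : finType) (x : N.-tuple S) : (0 < n)%N ->
  mixture (@mu_draw R S n N x) (kappa R n N).
Proof.
move=> n0; apply: eq_mixture (mixture_push (tnth x) (chi_mixture n0)) => y.
by rewrite mu_draw_push.
Qed.

Lemma tensor_push_mu_draw (S S' : finType) (f : S -> S') (x : N.-tuple S) :
  tensor_push f (@mu_draw R S n N x) =1 mu_draw R (map_tuple f x).
Proof.
move=> y; rewrite mu_drawE /tensor_push; under eq_bigr do rewrite mu_drawE.
rewrite -mulr_sumr exchange_big/=; congr (_ * _); apply: eq_bigr => s _.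
have -> : map_tuple (tnth (map_tuple f x)) (draw s) =
    map_tuple f (map_tuple (tnth x) (draw s)).
  by apply: eq_from_tnth => i; rewrite !tnth_map.
rewrite big_mkcond/= (bigD1 (map_tuple (tnth x) (draw s)))//= eqxx big1 ?addr0.
  by case: eqP.
by move=> z; rewrite eq_sym => /negPf ->; case: ifP.
Qed.

Lemma kappa_fin_kappa (S : finType) : (0 < n)%N -> (N <= #|S|)%N ->
  kappa_fin R S n N = kappa R n N.
Proof.
move=> n0 NS; apply/eqP; rewrite eq_le; apply/andP; split.
  apply/bigmax_leP; split; first exact: mixture_ge0 (chi_mixture n0).
  by move=> x _; exact/pisnorm_le/mu_draw_mixture.
have N0 := leq_trans n0 hnN.
pose f (i : 'I_N) : S := enum_val (widen_ord NS i).
(* A left inverse of the injection [f], with an arbitrary default off the range of [f]. *)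
pose g (s : S) : 'I_N := odflt (Ordinal N0) (insub (val (enum_rank s))).
have gf : cancel f g.
  by move=> i; rewrite /g /f enum_valK (_ : insub _ = Some i)//; exact: (@valK _ _ 'I_N).
pose x := [tuple f i | i < N].
apply: le_trans (le_bigmax _ _ x).
apply: pisnorm_le; have s0 := f (Ordinal N0).
(* An optimal mixture for the draw from [x] is pushed back by [g] to one for [chi], with the same
   bound. *)
apply: eq_mixture (mixture_push g (mixture_pisnorm s0 n0 (mu_draw_mixture x n0))) => y.
rewrite tensor_push_mu_draw mu_drawE chiE; congr (_ * _); apply: eq_bigr => s _.
congr (_ == _)%:R; apply: eq_from_tnth => i.
by rewrite [LHS]tnth_map [LHS]tnth_map tnth_mktuple gf.
Qed.

End draws.

(** * Finite nonnegative combinations of probability measures *)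

Section finite_mixture_measure.
Local Open Scope ereal_scope.
Context d (T : measurableType d) (R : realType) (J : finType).
Variables (w : J -> {nonneg R}) (m : J -> probability T R).

Definition fmix (A : set T) : \bar R := \sum_j (w j)%:num%:E * m j A.

(** Writing [fmix] as an [msum] over natural indices, with the zero measure from [#|J|] on, gives
    countable additivity and the integral formula at once. *)
Let mseq (i : nat) : {measure set T -> \bar R} :=
  if insub i is Some j then mscale (w (enum_val (j : 'I_#|J|))) (m (enum_val j))
  else mzero.

Let fmix_msum : fmix = msum mseq #|J|.
Proof.
apply/funext => A; rewrite /fmix /msum (reindex (fun i : 'I_#|J| => enum_val i))/=.
  by apply: eq_bigr => i _; rewrite /mseq valK.
exact/onW_bij/enum_val_bij.
Qed.

Let fmix0 : fmix set0 = 0.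
Proof. by rewrite fmix_msum measure0. Qed.

Let fmix_ge0 A : 0 <= fmix A.
Proof. by rewrite fmix_msum measure_ge0. Qed.

Let fmix_sigma_additive : semi_sigma_additive fmix.
Proof. by rewrite fmix_msum; exact: measure_semi_sigma_additive. Qed.

HB.instance Definition _ := isMeasure.Build _ _ _ fmix
  fmix0 fmix_ge0 fmix_sigma_additive.

Let fmix_fin_num : fin_num_fun fmix.
Proof.
move=> A mA; rewrite /fmix sum_fin_num; apply/allP => _ /mapP[j _ ->].
by rewrite inE fin_numM// fin_num_measure.
Qed.

HB.instance Definition _ := @Measure_isFinite.Build _ T R fmix fmix_fin_num.

Lemma fmixT : fmix setT = (\sum_j (w j)%:num)%:E.
Proof.
rewrite /fmix; under eq_bigr do rewrite probability_setT mule1.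
by rewrite sumEFin.
Qed.

Lemma ge0_integral_fmix (f : T -> \bar R) :
  (forall x, 0 <= f x) -> measurable_fun setT f ->
  \int[fmix]_x f x = \sum_j (w j)%:num%:E * \int[m j]_x f x.
Proof.
move=> f0 mf; rewrite (eq_measure_integral (msum mseq #|J|)); last first.
  by move=> A _ _; exact: (congr1 (@^~ A) fmix_msum).
rewrite ge0_integral_measure_sum//.
rewrite [RHS](reindex (fun i : 'I_#|J| => enum_val i))/=; last first.
  exact/onW_bij/enum_val_bij.
by apply: eq_bigr => i _; rewrite /mseq valK ge0_integral_mscale.
Qed.

End finite_mixture_measure.

(** * Finitely supported probability measures *)

Section finite_support.
Context d (T : measurableType d) (R : realType) (J : finType).
Variables (p : J -> R) (pp : prob_vec p) (x : J -> T).

Definition fsupp : set T -> \bar R :=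
  fmix (fun j => NngNum (pp.1 j)) (fun j => \d_(x j)).

HB.instance Definition _ := Measure.on fsupp.

Let fsuppT : fsupp setT = 1%E.
Proof. by rewrite /fsupp fmixT/= pp.2. Qed.

HB.instance Definition _ := Measure_isProbability.Build _ _ _ fsupp fsuppT.

Lemma fsuppE A : fsupp A = (\sum_j p j * \1_A (x j))%:E.
Proof. by rewrite -sumEFin; apply: eq_bigr => j _; rewrite EFinM. Qed.

Lemma ge0_integral_fsupp (f : T -> \bar R) :
  (forall x, 0 <= f x)%E -> measurable_fun setT f ->
  (\int[fsupp]_x f x = \sum_j (p j)%:E * f (x j))%E.
Proof.
move=> f0 mf; rewrite /fsupp ge0_integral_fmix//=; apply: eq_bigr => j _.
by rewrite integral_dirac// diracT mul1e.
Qed.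

End finite_support.

(** * Measurability of product powers in the base measure *)

Section ppow_theory.
Local Open Scope ereal_scope.
Context d (S : measurableType d) (R : realType).

Lemma measurable_pprobability d' (X : measurableType d') (P : X -> pprobability S R) :
  (forall U, measurable U -> measurable_fun setT (fun x => P x U)) ->
  measurable_fun setT P.
Proof.
move=> mP; apply: (measurability (@pset _ _ _ : set (set (pprobability S R)))) => //.
move=> _ [_ [r r01] [U mU <-]] <-; rewrite setTI.
rewrite (_ : _ @^-1` _ = (fun x => P x U) @^-1` `]-oo, r%:E[%classic); last first.
  by apply/seteqP; split => x/=; rewrite /mset/= in_itv.
by rewrite -[X in measurable X]setTI; apply: mP => //; exact: emeasurable_itv.
Qed.

Lemma ppow_ge0 (nu : probability S R) m A : 0 <= ppow nu m A.
Proof. by elim: m A => [|m ih] A //=; exact: integral_ge0. Qed.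

(** The parameter space [X] serves the induction on [m]: the first coordinate of the tuple joins the
    parameter, and the outer integral defining [ppow] is then an integral against a kernel. *)
Lemma measurable_ppow_section m d' (X : measurableType d') (B : set (X * m.-tuple S)) :
  measurable B ->
  measurable_fun setT (fun z : pprobability S R * X =>
    ppow z.1 m [set t | B (z.2, t)]).
Proof.
elim: m d' X B => [|m ih] d' X B mB /=.
  apply/measurable_EFinP.
  have mf : measurable_fun setT (fun z : pprobability S R * X => (z.2, [tuple] : 0.-tuple S)).
    exact: measurable_fun_pair.
  rewrite (_ : (fun _ => _) = mindic R mB \o (fun z : pprobability S R * X => (z.2, [tuple] : 0.-tuple S)))//.
  by apply: measurableT_comp => //; exact: measurable_indic.
pose B' : set ((X * S) * m.-tuple S) := [set z | B (z.1.1, cons_tuple z.1.2 z.2)].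
have mB' : measurable B'.
  have mf : measurable_fun setT (fun z : (X * S) * m.-tuple S =>
      (z.1.1, cons_tuple z.1.2 z.2)).
    apply: measurable_fun_pair; first exact: measurableT_comp.
    by apply: measurable_cons => //; apply: measurableT_comp.
  by rewrite -[X in measurable X]setTI; exact: mf.
pose k (z : (pprobability S R * X) * S) := ppow z.1.1 m [set t | B' ((z.1.2, z.2), t)].
have mk : measurable_fun setT k.
  have mf : measurable_fun setT (fun z : (pprobability S R * X) * S => (z.1.1, (z.1.2, z.2))).
    apply: measurable_fun_pair; first exact: measurableT_comp.
    by apply: measurable_fun_pair => //; exact: measurableT_comp.
  exact: measurableT_comp (ih _ _ B' mB') mf.
(* The first projection, read as a kernel, is the measure [nu] at the point [(nu, x)]. *)
have mP : measurable_fun setT (fst : pprobability S R * X -> pprobability S R).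
  exact: measurable_fst.
apply: (measurable_fun_integral_sfinite_kernel k (kprobability mP)) => //.
by move=> z; exact: ppow_ge0.
Qed.

Lemma measurable_ppow m (A : set (m.-tuple S)) : measurable A ->
  measurable_fun setT (fun nu : pprobability S R => ppow nu m A).
Proof.
move=> mA; pose B : set (S * m.-tuple S) := setT `*` A.
have mB : measurable B by exact: measurableX.
have mf : measurable_fun setT (fun nu : pprobability S R => (nu, point : S)).
  exact: measurable_fun_pair.
have := measurableT_comp (measurable_ppow_section mB) mf.
rewrite (_ : _ \o _ = fun nu : pprobability S R => ppow nu m A)//.
apply/funext => nu /=; congr (ppow nu m _).
by apply/seteqP; split => t //= [].
Qed.

Lemma measurable_ppow_cons (nu : probability S R) m (A : set (m.+1.-tuple S)) :
  measurable A ->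
  measurable_fun setT (fun x : S => ppow nu m [set t | A (cons_tuple x t)]).
Proof.
move=> mA; pose B : set (S * m.-tuple S) := [set z | A (cons_tuple z.1 z.2)].
have mB : measurable B.
  have mf : measurable_fun setT (fun z : S * m.-tuple S => cons_tuple z.1 z.2).
    exact: measurable_cons.
  by rewrite -[X in measurable X]setTI; exact: mf.
have mf : measurable_fun setT (fun x : S => (nu : pprobability S R, x)).
  exact: measurable_fun_pair.
exact: measurableT_comp (measurable_ppow_section mB) mf.
Qed.

End ppow_theory.

(** * Representing measures built from mixtures *)

Section representation.
Context d (S : measurableType d) (R : realType).

Lemma sum_tuple_cons (J : finType) m (F : m.+1.-tuple J -> R) :
  \sum_t F t = \sum_i \sum_(y : m.-tuple J) F (cons_tuple i y).
Proof.
rewrite pair_big/= (reindex (fun z : J * m.-tuple J => cons_tuple z.1 z.2))//=.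
exists (fun t => (thead t, behead_tuple t)) => [[i y] _|t _] /=.
  by congr pair; apply: val_inj.
by apply: val_inj; rewrite /= [in RHS](tuple_eta t).
Qed.

Lemma ppow_fsupp (J : finType) (p : J -> R) (pp : prob_vec p) (x : J -> S) m
    (A : set (m.-tuple S)) : measurable A ->
  ppow (fsupp pp x) m A =
  (\sum_(y : m.-tuple J) tensor_pow p y * \1_A (map_tuple x y))%:E.
Proof.
elim: m A => [|m ih] A mA /=.
  rewrite (bigD1 [tuple])//= big1; last by move=> y /eqP; case; exact: tuple0.
  rewrite addr0 /tensor_pow big_ord0 mul1r diracE indicE.
  by rewrite [map_tuple _ _]tuple0.
rewrite ge0_integral_fsupp; last 2 first.
- by move=> s; exact: ppow_ge0.
- exact: measurable_ppow_cons.
rewrite sum_tuple_cons -sumEFin; apply: eq_bigr => i _.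
have mAi : measurable [set t : m.-tuple S | A (cons_tuple (x i) t)].
  have mf : measurable_fun setT (fun t : m.-tuple S => cons_tuple (x i) t).
    exact: measurable_cons.
  by rewrite -[X in measurable X]setTI; exact: mf.
rewrite ih// -EFinM mulr_sumr; congr EFin; apply: eq_bigr => y _.
rewrite mulrA; congr (_ * _).
  rewrite /tensor_pow big_ord_recl; congr (_ * _).
  by apply: eq_bigr => j _; rewrite tnthS.
rewrite !indicE; congr (_ _)%:R.
rewrite (_ : map_tuple x (cons_tuple i y) = cons_tuple (x i) (map_tuple x y)).
  by apply/idP/idP; rewrite !inE.
exact: val_inj.
Qed.

(** This makes the weighted empirical measure of the points [x j w] a random element of
    [pprobability S R], whose law can be taken. *)
Lemma measurable_fsupp d' (X : measurableType d') (J : finType) (p : J -> R)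
    (pp : prob_vec p) (x : J -> X -> S) :
  (forall j, measurable_fun setT (x j)) ->
  measurable_fun setT (fun w => fsupp pp (x ^~ w) : pprobability S R).
Proof.
move=> mx; apply: measurable_pprobability => U mU.
rewrite (_ : (fun w => _) = fun w => (\sum_j p j * \1_U (x j w))%:E); last first.
  by apply/funext => w; exact: fsuppE.
apply/measurable_EFinP; apply: measurable_sum => j.
apply: measurable_funM => //; apply: (measurableT_comp _ (mx j)).
exact: measurable_indic.
Qed.

Lemma bigcup_ord k (T : Type) (A : 'I_k -> set T) :
  \bigcup_(i in setT) A i = \big[setU/set0]_(i < k) A i.
Proof.
rewrite -bigcup_seq; apply: eq_bigcupl; split => i //= _.
by rewrite mem_index_enum.
Qed.

Lemma tvnormB_le d' (X : measurableType d')
    (l1 l2 : {finite_measure set X -> \bar R}) (l : set X -> \bar R) :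
  (forall B, measurable B -> l B = (l1 B - l2 B)%E) ->
  (tvnorm l <= l1 setT + l2 setT)%E.
Proof.
move=> lE; apply: ge_ereal_sup => _ [k [A [mA tA AT ->]]].
have sumE (m : {finite_measure set X -> \bar R}) : (\sum_(i < k) m (A i) = m setT)%E.
  rewrite -AT bigcup_ord measure_semi_additive_ord//.
  by rewrite -bigcup_ord AT.
rewrite -!sumE -big_split/=; apply: lee_sum => i _.
rewrite lE// (le_trans (lee_abs_sub _ _))//.
by rewrite !gee0_abs.
Qed.

(** The law [lam i] of the random measure with weights [p i] averages [nu^n] to the expectation of
    the [i]-th power summed over tuples [y], so [l] combines the [lam i] with the coefficients of
    [T]. Random points [x] serve an arbitrary space, constant ones a finite space. *)
Lemma represents_mixture n (I : finType) (T : n.-tuple I -> R) r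
    d' (X : measurableType d') (Q : probability X R) (x : I -> X -> S)
    (mu : set (n.-tuple S) -> \bar R) :
  (forall i, measurable_fun setT (x i)) -> mixture T r ->
  (forall A, measurable A ->
    mu A = (\sum_y (T y)%:E * Q [set w | A (map_tuple (x ^~ w) y)])%E) ->
  exists l : {charge set (pprobability S R) -> \bar R},
    represents mu l /\ (tvnorm l <= r%:E)%E.
Proof.
move=> mx [k [a [p [pp TE ar]]]] muE.
pose g i w : pprobability S R := fsupp (pp i) (x ^~ w).
have mg i : measurable_fun setT (g i) by exact: measurable_fsupp.
pose gp i : {mfun X >-> pprobability S R} :=
  HB.pack (g i) (isMeasurableFun.Build _ _ _ _ (g i) (mg i)).
pose lam i : probability (pprobability S R) R := distribution Q (gp i).
(* The coefficients are split into positive and negative parts, which weight the finite measures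
   [l1] and [l2]. *)
have maxE i : Num.max (a i) 0 + Num.max (- a i) 0 = `|a i| /\
    Num.max (a i) 0 - Num.max (- a i) 0 = a i.
  have [a0|] := boolP (0 <= a i); last rewrite -ltNge => a0.
    have /max_idPl -> := a0; have /max_idPr -> : - a i <= 0 by rewrite oppr_le0.
    by rewrite addr0 subr0 ger0_norm.
  have /max_idPr -> := ltW a0; have /max_idPl -> : 0 <= - a i by rewrite oppr_ge0 ltW.
  by rewrite add0r sub0r opprK ltr0_norm.
have wp0 i : 0 <= Num.max (a i) 0 by rewrite le_max lexx orbT.
have wm0 i : 0 <= Num.max (- a i) 0 by rewrite le_max lexx orbT.
pose l1 : {finite_measure set (pprobability S R) -> \bar R} :=
  fmix (fun i => NngNum (wp0 i)) lam.
pose l2 : {finite_measure set (pprobability S R) -> \bar R} :=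
  fmix (fun i => NngNum (wm0 i)) lam.
pose l : {charge set (pprobability S R) -> \bar R} :=
  cadd (charge_of_finite_measure l1) (copp (charge_of_finite_measure l2)).
have lE B : measurable B -> l B = (l1 B - l2 B)%E by [].
exists l; split; last first.
  apply: le_trans (tvnormB_le lE) _.
  have -> : l1 setT = (\sum_i Num.max (a i) 0)%:E by exact: fmixT.
  have -> : l2 setT = (\sum_i Num.max (- a i) 0)%:E by exact: fmixT.
  rewrite -EFinD lee_fin; apply: le_trans ar.
  rewrite -big_split/=; apply: ler_sum => i _.
  by have [-> _] := maxE i.
exists l1, l2; split => // A mA.
pose q y := fine (Q [set w | A (map_tuple (x ^~ w) y)]).
have mxy (y : n.-tuple I) : measurable [set w | A (map_tuple (x ^~ w) y)].
  have mf : measurable_fun setT (fun w => map_tuple (x ^~ w) y : n.-tuple S).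
    apply/measurable_fun_tnthP => j.
    rewrite (_ : _ \o _ = x (tnth y j)); first exact: mx.
    by apply/funext => w /=; rewrite tnth_map.
  by rewrite -[X in measurable X]setTI; exact: mf.
have qE y : Q [set w | A (map_tuple (x ^~ w) y)] = (q y)%:E.
  by rewrite fineK// fin_num_measure.
have intE i : (\int[lam i]_nu ppow nu n A = (\sum_y tensor_pow (p i) y * q y)%:E)%E.
  rewrite ge0_integral_distribution; last 2 first.
  - exact: measurable_ppow.
  - by move=> nu; exact: ppow_ge0.
  under eq_integral do rewrite /= ppow_fsupp// -sumEFin.
  have tp0 y : 0 <= tensor_pow (p i) y by apply: prodr_ge0 => j _; case: (pp i).
  have mind y : measurable_fun setT (fun w => \1_A (map_tuple (x ^~ w) y) : R).
    rewrite (_ : (fun w => _) = \1_[set w | A (map_tuple (x ^~ w) y)]).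
      exact: measurable_indic.
    by apply/funext => w; rewrite !indicE; congr (_ _)%:R; apply/idP/idP; rewrite !inE.
  rewrite ge0_integral_sum//=; last 2 first.
  - by move=> y; apply/measurable_EFinP; exact: measurable_funM.
  - by move=> y w _; rewrite lee_fin mulr_ge0.
  rewrite -sumEFin; apply: eq_bigr => y _; under eq_integral do rewrite EFinM.
  rewrite ge0_integralZl_EFin//=; last exact/measurable_EFinP.
  rewrite EFinM -qE; congr (_ * _)%E.
  transitivity (\int[Q]_w (\1_[set w | A (map_tuple (x ^~ w) y)] w)%:E)%E; last first.
    by rewrite integral_indic// setIT.
  by apply: eq_integral => w _; rewrite !indicE; congr (_ _)%:R%:E; apply/idP/idP; rewrite !inE.
have intM (w : 'I_k -> R) (w0 : forall i, 0 <= w i) :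
    (\int[fmix (fun i => NngNum (w0 i)) lam]_nu ppow nu n A =
     (\sum_i w i * \sum_y tensor_pow (p i) y * q y)%:E)%E.
  rewrite ge0_integral_fmix; last 2 first.
  - by move=> nu; exact: ppow_ge0.
  - exact: measurable_ppow.
  by rewrite -sumEFin; apply: eq_bigr => i _; rewrite intE -EFinM.
rewrite muE// [X in (X - _)%E]intM [X in (_ - X)%E]intM.
under eq_bigr do rewrite qE -EFinM.
rewrite sumEFin -EFinB -sumrB; congr EFin.
under [RHS]eq_bigr => i _.
  rewrite /= -mulrBl (proj2 (maxE i)).
  rewrite mulr_sumr.
  over.
rewrite exchange_big/=; apply: eq_bigr => y _.
by rewrite TE mulr_suml; apply: eq_bigr => i _; rewrite mulrA.
Qed.

End representation.

(** * Measures on finite discrete spaces *)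

Section discrete.
Context d (T : measurableType d) (R : realType).

(** The bijection [i] separates the finite type indexing the sum from the measurable type carrying
    [mu]; it is instantiated by the identity. *)
Lemma discrete_measureE (J : finType) (i : J -> T) (mu : probability T R) (A : set T) :
  bijective i -> (forall B : set T, measurable B) ->
  mu A = (\sum_j fine (mu [set i j]) * \1_A (i j))%:E.
Proof.
move=> [i' ii' i'i] mT.
pose F (k : 'I_#|J|) := A `&` [set i (enum_val k)].
have AE : A = \bigcup_(k in setT) F k.
  apply/seteqP; split => [x Ax|x [k _ []//]].
  by exists (enum_rank (i' x)) => //; split => //=; rewrite enum_rankK i'i.
have -> : mu A = (\sum_k mu (F k))%E.
  rewrite {1}AE bigcup_ord measure_semi_additive_ord//.
  apply/trivIsetP => k k' _ _; apply: contraNeq => /set0P[x [[_ ->] [_ /(can_inj ii')]]].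
  by move/enum_val_inj ->.
rewrite -sumEFin (reindex (fun k : 'I_#|J| => enum_val k))/=; last exact/onW_bij/enum_val_bij.
apply: eq_bigr => k _; rewrite /F indicE.
have [Ax|Ax] := boolP (_ \in A).
  rewrite mulr1 fineK ?fin_num_measure//; congr (mu _).
  by apply/seteqP; split => [x []//|x /= ->]; split => //; exact: set_mem.
rewrite mulr0 (_ : _ `&` _ = set0) ?measure0//.
apply/seteqP; split => // x [/= Ax' xE]; move/negP: Ax; apply.
by rewrite -xE; exact: mem_set.
Qed.

End discrete.

Section finite_space.
Context (S : finType) (s0 : S) (R : realType).
Local Notation F := (fdisc s0).

(** A singleton is a finite intersection of coordinate preimages, and every set of tuples is a
    finite union of singletons. *)
Lemma measurable_fdisc_tuple n (A : set (n.-tuple F)) : measurable A.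
Proof.
rewrite (_ : A = \bigcup_(t in A) [set t]); last first.
  by apply/seteqP; split => [t At|t [u Au ->]]//; exists t.
apply: fin_bigcup_measurable.
  exact: (@finite_finset (n.-tuple S : finType) A).
move=> t _.
rewrite (_ : [set t] = \bigcap_(i in [set: 'I_n]) (fun u : n.-tuple F => tnth u i) @^-1` [set tnth t i]).
  apply: fin_bigcap_measurable => // i _.
  by rewrite -[X in measurable X]setTI; exact: measurable_tnth.
apply/seteqP; split => [u -> //|u ut]; apply: eq_from_tnth => i; exact: ut.
Qed.

Definition pvec (nu : probability F R) (s : S) : R := fine (nu [set (s : F)]).

Lemma fdisc_measureE (nu : probability F R) A :
  nu A = (\sum_(s : S) pvec nu s * \1_A (s : F))%:E.
Proof. by apply: (@discrete_measureE _ F R S id) => //; exists id. Qed.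

Lemma fdisc_tuple_measureE n (mu : probability (n.-tuple F) R) A :
  mu A = (\sum_(t : n.-tuple S) fine (mu [set (t : n.-tuple F)]) * \1_A (t : n.-tuple F))%:E.
Proof.
apply: (@discrete_measureE _ (n.-tuple F) R (n.-tuple S : finType) id).
  by exists id.
exact: measurable_fdisc_tuple.
Qed.

Lemma pvec_prob (nu : probability F R) : prob_vec (pvec nu).
Proof.
split => [s|]; first by rewrite fine_ge0.
have := fdisc_measureE nu setT; rewrite probability_setT => -[->].
by apply: eq_bigr => s _; rewrite indicT mulr1.
Qed.

Lemma eq_ppow d (T : measurableType d) (nu nu' : probability T R) m A :
  (forall B, measurable B -> nu B = nu' B) -> ppow nu m A = ppow nu' m A.
Proof.
move=> E; elim: m A => //= m ih A.
rewrite (eq_measure_integral nu'); last by move=> B mB _; exact: E.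
by apply: eq_integral => x _; exact: ih.
Qed.

Lemma ppow_set1 n (nu : probability F R) (t : n.-tuple S) :
  ppow nu n [set (t : n.-tuple F)] = (tensor_pow (pvec nu) t)%:E.
Proof.
rewrite (@eq_ppow _ _ nu (fsupp (pvec_prob nu) (id : S -> F))); last first.
  by move=> B _; rewrite (fdisc_measureE nu); exact/esym/fsuppE.
rewrite ppow_fsupp; last exact: measurable_fdisc_tuple.
have mapE (y : n.-tuple S) : map_tuple (id : S -> F) y = y.
  by apply: val_inj; rewrite /= map_id.
rewrite (bigD1 t)//= mapE indicE mem_set// mulr1 big1 ?addr0// => y yt.
rewrite mapE indicE memNset ?mulr0//= => ty.
by rewrite ty eqxx in yt.
Qed.

End finite_space.

(** * Lower bounds by discretising a representing measure *)

Lemma ge0_le_integralD d (T : measurableType d) (R : realType)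
    (m : {finite_measure set T -> \bar R}) (f h : T -> R) (e : R) :
  (forall x, 0 <= f x) -> (forall x, 0 <= h x) -> 0 <= e ->
  measurable_fun setT f -> measurable_fun setT h ->
  (forall x, f x <= h x + e) ->
  (\int[m]_x (f x)%:E <= \int[m]_x (h x)%:E + e%:E * m setT)%E.
Proof.
move=> f0 h0 e0 mf mh fh.
rewrite -integral_cst// -ge0_integralD//=; last 2 first.
- by move=> x _; rewrite lee_fin.
- exact/measurable_EFinP.
have mfE : measurable_fun setT (EFin \o f) by exact/measurable_EFinP.
have mhE : measurable_fun setT (fun x => ((h x)%:E + e%:E)%E).
  by apply/measurable_EFinP; exact: measurable_funD.
by apply: ge0_le_integral => // x _; rewrite lee_fin.
Qed.

(** Otherwise the first grid point strictly above [f], which is at most [f + 1/K], would lie below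
    [g] and separate the two; as [g <= 1], its index is less than [K]. *)
Lemma grid_dist (R : realType) (K : nat) (f g : R) : (0 < K)%N ->
  0 <= f -> 0 <= g <= 1 ->
  (forall i : 'I_K, (i%:R / K%:R <= f) = (i%:R / K%:R <= g)) ->
  g <= f + K%:R^-1.
Proof.
move=> K0 f0 /andP[g0 g1] fg; rewrite leNgt; apply/negP => fgK.
have K0' : 0 < K%:R :> R by rewrite ltr0n.
have Kf0 : 0 <= K%:R * f by rewrite mulr_ge0// ltW.
have /andP[if1 if2] := truncn_itv Kf0.
set i := (Num.truncn (K%:R * f)).+1 in if2.
have iK : i%:R / K%:R <= f + K%:R^-1.
  by rewrite ler_pdivrMr// mulrDl mulVf ?gt_eqF// /i -natr1 lerD2r [leRHS]mulrC.
have ig : i%:R / K%:R < g by apply: le_lt_trans fgK.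
have iltK : (i < K)%N.
  rewrite -(ltr_nat R) -[ltRHS]mul1r -ltr_pdivrMr//.
  exact: lt_le_trans g1.
have := fg (Ordinal iltK); rewrite /= (ltW ig) => /idP.
by rewrite ler_pdivrMr// mulrC leNgt if2.
Qed.

Section lower_bound.
Context (S : finType) (s0 : S) (R : realType) (n : nat).
Local Notation F := (fdisc s0).

(* The simplex is cut into finitely many cells on which all the coordinates of
   [nu^n] oscillate by at most [1/K]; freezing [nu] on each cell turns the
   representing measure into a finite mixture. *)
Lemma represents_lower (mu : probability (n.-tuple F) R)
    (l : {charge set (pprobability F R) -> \bar R}) M :
  represents mu l -> (tvnorm l <= M%:E)%E ->
  mixture (fun t : n.-tuple S => fine (mu [set (t : n.-tuple F)])) M.
Proof.
move=> [l1 [l2 [lE muE]]] lM; apply: (mixture_closed s0) => e e0.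
pose C := fine (l1 setT) + fine (l2 setT).
have C0 : 0 <= C by rewrite addr_ge0// fine_ge0.
(* The mesh makes the total error [C / K] at most [e]. The masses of [l1] and [l2] may exceed the
   variation of [l], but they affect only [K], not the bound [M]. *)
pose K := (Num.truncn (C / e)).+1.
have K0 : 0 < K%:R :> R by rewrite ltr0n.
have CK : C * K%:R^-1 <= e.
  rewrite ler_pdivrMr// mulrC -ler_pdivrMr//; apply/ltW.
  by have /andP[] := truncn_itv (divr_ge0 C0 (ltW e0)).
pose f (t : n.-tuple S) (nu : pprobability F R) := tensor_pow (pvec nu) t.
have mf t : measurable_fun setT (f t).
  apply/measurable_EFinP; have := @measurable_ppow _ F R n [set (t : n.-tuple F)]
    (@measurable_fdisc_tuple _ _ _ _).
  rewrite (_ : (fun _ => _) = EFin \o f t)//.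
  by apply/funext => nu; exact: ppow_set1.
have f01 t nu : 0 <= f t nu <= 1.
  rewrite /f /tensor_pow prodr_ge0/=; last by move=> j _; case: (pvec_prob nu).
  apply: prodr_ile1 => j _; have [p0 p1] := pvec_prob nu.
  by rewrite p0/= -p1 (bigD1 (tnth t j))//= lerDl sumr_ge0.
pose G : finType := {ffun (n.-tuple S) * 'I_K -> bool}.
(* The cell of [nu] records which thresholds [i / K] are reached by each coordinate of its [n]-th
   power. *)
pose cell (nu : pprobability F R) : G := [ffun z : n.-tuple S * 'I_K => z.2%:R / K%:R <= f z.1 nu].
pose A (k : 'I_#|G|) : set (pprobability F R) := [set nu | cell nu = enum_val k].
have mA k : measurable (A k).
  rewrite (_ : A k = \bigcap_(z in [set: (n.-tuple S) * 'I_K])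
      [set nu | (z.2%:R / K%:R <= f z.1 nu) = (enum_val k : G) z]); last first.
    apply/seteqP; split => [nu /= nuk z _|nu nuk] /=; first by rewrite -nuk ffunE.
    by apply/ffunP => z; rewrite ffunE; exact: nuk.
  apply: fin_bigcap_measurable; first exact: finite_finset.
  move=> z _; have mz : measurable [set nu | z.2%:R / K%:R <= f z.1 nu].
    rewrite (_ : [set nu | _] = f z.1 @^-1` `[z.2%:R / K%:R, +oo[%classic).
      by rewrite -[X in measurable X]setTI; exact: mf.
    by apply/seteqP; split => nu /=; rewrite in_itv/= andbT.
  case: ((enum_val k : G) z).
    by rewrite (_ : [set nu | _] = [set nu | z.2%:R / K%:R <= f z.1 nu]).
  rewrite (_ : [set nu | _] = ~` [set nu | z.2%:R / K%:R <= f z.1 nu]).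
    exact: measurableC.
  by apply/seteqP; split => nu /= => [->//|/negP/negbTE].
have tA : trivIset setT A.
  apply/trivIsetP => k k' _ _; apply: contraNeq => /set0P[nu [/= nuk nuk']].
  by apply/eqP/enum_val_inj; rewrite -nuk -nuk'.
have AT : \bigcup_(k in setT) A k = setT.
  apply/seteqP; split => // nu _; exists (enum_rank (cell nu)) => //.
  by rewrite /A/= enum_rankK.
(* An empty cell receives an arbitrary representative. *)
have /choice[rep repP] : forall k, exists nu : pprobability F R, A k !=set0 -> A k nu.
  move=> k; have [[nu Ak]|nA] := pselect (A k !=set0); first by exists nu.
  by exists point.
pose c t k := f t (rep k).
pose h t nu := \sum_k c t k * \1_(A k) nu.
have hE t nu : h t nu = c t (enum_rank (cell nu)).
  rewrite /h (bigD1 (enum_rank (cell nu)))//= indicE mem_set; last first.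
    by rewrite /A/= enum_rankK.
  rewrite mulr1 big1 ?addr0// => k kn; rewrite indicE memNset ?mulr0// => nuk.
  by move: kn; rewrite nuk enum_valK eqxx.
have fh t nu : f t nu <= h t nu + K%:R^-1 /\ h t nu <= f t nu + K%:R^-1.
  rewrite hE; set k := enum_rank _.
  have Anu : A k nu by rewrite /A/= enum_rankK.
  have Ar : A k (rep k) by apply: repP; exists nu.
  have same (i : 'I_K) : (i%:R / K%:R <= f t nu) = (i%:R / K%:R <= c t k).
    have : cell nu (t, i) = cell (rep k) (t, i) by rewrite Anu Ar.
    by rewrite !ffunE.
  have /andP[fn0 _] := f01 t nu; have /andP[fr0 _] := f01 t (rep k).
  by split; apply: grid_dist => //; exact: f01.
have mck t k : measurable_fun setT (fun nu => c t k * \1_(A k) nu).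
  by apply: measurable_funM => //; exact: measurable_indic.
have mh t : measurable_fun setT (h t).
  by apply: measurable_sum => k; exact: mck.
have c0 t k : 0 <= c t k by have /andP[] := f01 t (rep k).
have h0 t nu : 0 <= h t nu by rewrite hE.
have f0 t nu : 0 <= f t nu by have /andP[] := f01 t nu.
have inth (m : {finite_measure set (pprobability F R) -> \bar R}) t :
    (\int[m]_nu (h t nu)%:E = (\sum_k c t k * fine (m (A k)))%:E)%E.
  under eq_integral do rewrite /h -sumEFin.
  rewrite ge0_integral_sum//=; last 2 first.
  - by move=> k; apply/measurable_EFinP; exact: mck.
  - by move=> k nu _; rewrite lee_fin mulr_ge0.
  rewrite -sumEFin; apply: eq_bigr => k _; under eq_integral do rewrite EFinM.
  rewrite ge0_integralZl_EFin//=; last by apply/measurable_EFinP; exact: measurable_indic.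
  by rewrite integral_indic// setIT EFinM fineK// fin_num_measure.
have intf (m : {finite_measure set (pprobability F R) -> \bar R}) t :
    exists2 r, (\int[m]_nu ppow nu n [set (t : n.-tuple F)] = r%:E)%E &
      `|r - \sum_k c t k * fine (m (A k))| <= K%:R^-1 * fine (m setT).
  under eq_integral do rewrite ppow_set1.
  have mT : m setT = (fine (m setT))%:E by rewrite fineK// fin_num_measure.
  have := ge0_le_integralD m (f0 t) (h0 t) (ltW (_ : 0 < K%:R^-1)) (mf t) (mh t)
    (fun nu => (fh t nu).1).
  have := ge0_le_integralD m (h0 t) (f0 t) (ltW (_ : 0 < K%:R^-1)) (mh t) (mf t)
    (fun nu => (fh t nu).2).
  rewrite !invr_gt0 => /(_ K0) + /(_ K0).
  rewrite inth mT -EFinM -EFinD.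
  have : (0 <= \int[m]_nu (f t nu)%:E)%E by apply: integral_ge0 => nu _; rewrite lee_fin.
  (* Nonnegativity excludes [-oo], and the finite upper bound through [h] excludes [+oo]. *)
  case: (\int[m]_nu (f t nu)%:E)%E => [r| |]//= _.
  rewrite -EFinD !lee_fin => le1 le2; exists r => //.
  by rewrite ler_norml lerBlDl le2 andbT lerNl opprB lerBlDl.
have lfin k : l (A k) = (fine (l1 (A k)) - fine (l2 (A k)))%:E.
  by rewrite lE// EFinB !fineK// fin_num_measure.
exists (fun t => \sum_k fine (l (A k)) * tensor_pow (pvec (rep k)) t); split.
  apply: (@mixture_fin _ _ _ _ (fun k => fine (l (A k))) (fun k => pvec (rep k))) => //.
    by move=> k; exact: pvec_prob.
  apply: (@le_trans _ _ M); last by rewrite lerDl ltW.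
  (* The cells form one of the finite partitions over which [tvnorm] takes its supremum. *)
  rewrite -lee_fin; apply: le_trans lM; apply: ereal_sup_ubound.
  exists #|G|, A; split => //; rewrite -sumEFin; apply: eq_bigr => k _.
  by rewrite lfin.
move=> t; rewrite muE; last exact: measurable_fdisc_tuple.
have [r1 -> r1K] := intf l1 t; have [r2 -> r2K] := intf l2 t.
rewrite -EFinB/=; apply: le_trans CK.
have -> : \sum_k fine (l (A k)) * tensor_pow (pvec (rep k)) t =
    \sum_k c t k * fine (l1 (A k)) - \sum_k c t k * fine (l2 (A k)).
  rewrite -sumrB; apply: eq_bigr => k _; rewrite lfin/= -mulrBr mulrC.
  by [].
rewrite mulrC mulrDr opprD addrACA -opprD.
exact: le_trans (ler_normB _ _) (lerD r1K r2K).
Qed.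

End lower_bound.

(** * Extendible laws as averages of draws *)

Section extendible.
Variables (R : realType) (n N : nat).
Hypothesis hnN : (n <= N)%N.

Lemma extendible_chi d (S : measurableType d) (mu : set (n.-tuple S) -> \bar R)
    (muN : probability (N.-tuple S) R) :
  exchangeable muN ->
  (forall A : set (n.-tuple S), measurable A ->
    mu A = muN ((fun t : N.-tuple S => [tuple tnth t (widen_ord hnN i) | i < n])
                    @^-1` A)) ->
  forall A : set (n.-tuple S), measurable A ->
    mu A = (\sum_y (chi R y)%:E * muN [set w | A (map_tuple (tnth w) y)])%E.
Proof.
move=> exN ext A mA.
have mtn (y : n.-tuple 'I_N) : measurable [set w : N.-tuple S | A (map_tuple (tnth w) y)].
  have mf : measurable_fun setT (fun w : N.-tuple S => map_tuple (tnth w) y).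
    apply/measurable_fun_tnthP => j.
    rewrite (_ : _ \o _ = (fun w : N.-tuple S => tnth w (tnth y j))).
      exact: measurable_tnth.
    by apply/funext => w /=; rewrite tnth_map.
  by rewrite -[X in measurable X]setTI; exact: mf.
pose q y := fine (muN [set w | A (map_tuple (tnth w) y)]).
have qE y : muN [set w | A (map_tuple (tnth w) y)] = (q y)%:E.
  by rewrite fineK// fin_num_measure.
have widenE (w : N.-tuple S) : [tuple tnth w (widen_ord hnN i) | i < n] =
    map_tuple (tnth w) (draw hnN 1%g).
  by apply: eq_from_tnth => i; rewrite [RHS]tnth_map !tnth_mktuple perm1.
have permE (s : 'S_N) (w : N.-tuple S) :
    [tuple tnth [tuple tnth w (s i) | i < N] (widen_ord hnN i) | i < n] =
    map_tuple (tnth w) (draw hnN s).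
  by apply: eq_from_tnth => i; rewrite [RHS]tnth_map !tnth_mktuple.
(* By exchangeability of [muN], any [n] distinct coordinates of the extension, in any order, have
   law [mu]; averaging over [s] then produces the weights [chi]. *)
have mudraw s : mu A = (q (draw hnN s))%:E.
  rewrite ext// (exN s); last first.
    rewrite (_ : _ @^-1` _ = [set w : N.-tuple S | A (map_tuple (tnth w) (draw hnN 1%g))]).
      exact: mtn.
    by apply/seteqP; split => w /=; rewrite widenE.
  by rewrite -qE; congr (muN _); apply/seteqP; split => w /=; rewrite permE.
under eq_bigr do rewrite qE -EFinM chiE.
rewrite sumEFin.
under eq_bigr do rewrite -mulrA.
rewrite -mulr_sumr; under eq_bigr do rewrite mulr_suml.
rewrite exchange_big/=.
have muAE : mu A = (fine (mu A))%:E by rewrite (mudraw 1%g).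
rewrite (eq_bigr (fun=> fine (mu A))); last first.
  move=> s _; rewrite (bigD1 (draw hnN s))//= eqxx mul1r big1 ?addr0.
    by rewrite (mudraw s).
  by move=> y; rewrite eq_sym => /negPf ->; rewrite mul0r.
by rewrite sumr_const card_Sn -[fine _ *+ _]mulr_natl mulKf.
Qed.

(** These laws are the extremal examples for both lower bounds; a uniformly random rearrangement of
    all of [x] is the exchangeable extension. *)
Lemma mu_draw_law (S : finType) (s0 : S) (x : N.-tuple S) :
  exists mu : probability (n.-tuple (fdisc s0)) R,
    [/\ exchangeable mu, extendible hnN mu &
      forall t : n.-tuple S, mu [set (t : n.-tuple (fdisc s0))] = (mu_draw R x t)%:E].
Proof.
have up : prob_vec (fun _ : 'S_N => (N`!)%:R^-1 : R).
  split; first by move=> _; rewrite invr_ge0.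
  by rewrite sumr_const card_Sn -[_^-1 *+ _]mulr_natl divff// pnatr_eq0 -lt0n fact_gt0.
pose zN (s : 'S_N) : N.-tuple (fdisc s0) := [tuple tnth x (s i) | i < N].
pose z (s : 'S_N) : n.-tuple (fdisc s0) := map_tuple (tnth x) (draw hnN s).
have zE s i : tnth (z s) i = tnth x (s (widen_ord hnN i)).
  by rewrite /z [LHS]tnth_map tnth_mktuple.
pose mu : probability (n.-tuple (fdisc s0)) R := fsupp up z.
pose muN : probability (N.-tuple (fdisc s0)) R := fsupp up zN.
have muE A : mu A = (\sum_s (N`!)%:R^-1 * \1_A (z s))%:E by exact: fsuppE.
have muNE A : muN A = (\sum_s (N`!)%:R^-1 * \1_A (zN s))%:E by exact: fsuppE.
exists mu; split.
- move=> g A _; rewrite !muE; congr EFin.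
  (* The permutation [g] of the first [n] positions extends to a permutation [h] of [N], and left
     multiplication by [h] reindexes the sum. *)
  have [h hg] : exists h, draw hnN h = [tuple tnth (draw hnN 1%g) (g i) | i < n].
    apply: draw_onto; rewrite map_inj_uniq ?enum_uniq// => i j.
    by rewrite !tnth_mktuple !perm1 => /(congr1 val)/= /val_inj /perm_inj.
  have hE i : h (widen_ord hnN i) = widen_ord hnN (g i).
    have := congr1 (fun t => tnth t i) hg.
    by rewrite !tnth_mktuple perm1.
  rewrite [LHS](reindex_inj (mulgI h))/=; apply: eq_bigr => s _; congr (_ * _).
  rewrite !indicE; congr (_ _)%:R; rewrite (_ : z (h * s)%g = [tuple tnth (z s) (g i) | i < n]).
    by apply/idP/idP; rewrite !inE.
  by apply: eq_from_tnth => i; rewrite tnth_mktuple !zE permM hE.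
- exists muN; split.
    move=> g A _; rewrite !muNE; congr EFin.
    rewrite [LHS](reindex_inj (mulgI g))/=; apply: eq_bigr => s _; congr (_ * _).
    rewrite !indicE; congr (_ _)%:R; rewrite (_ : zN (g * s)%g = [tuple tnth (zN s) (g i) | i < N]).
      by apply/idP/idP; rewrite !inE.
    by apply: eq_from_tnth => i; rewrite !tnth_mktuple permM.
  move=> A _; rewrite muE muNE; congr EFin; apply: eq_bigr => s _; congr (_ * _).
  rewrite !indicE; congr (_ _)%:R.
  rewrite (_ : z s = [tuple tnth (zN s) (widen_ord hnN i) | i < n]).
    by apply/idP/idP; rewrite !inE.
  by apply: eq_from_tnth => i; rewrite zE !tnth_mktuple.
- move=> t; rewrite muE (mu_drawE R hnN) mulr_sumr; congr EFin.
  apply: eq_bigr => s _; congr (_ * _); rewrite indicE; congr (_ _)%:R.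
  by apply/idP/eqP; rewrite inE.
Qed.

(** Conditioning on the value [w] of the extension writes [mu] as the average of the draws from [w],
    with weights [q w] summing to 1; so the largest of their norms bounds the average. *)
Lemma extendible_mixture (S : finType) (s0 : S) (mu : probability (n.-tuple (fdisc s0)) R) :
  (0 < n)%N -> extendible hnN mu ->
  mixture (fun t : n.-tuple S => fine (mu [set (t : n.-tuple (fdisc s0))]))
    (kappa_fin R S n N).
Proof.
move=> n0 [muN [exN ext]].
pose q (w : N.-tuple S) := fine (muN [set (w : N.-tuple (fdisc s0))]).
have q0 w : 0 <= q w by rewrite fine_ge0.
have q1 : \sum_w q w = 1.
  have := fdisc_tuple_measureE muN setT; rewrite probability_setT => -[->].
  by apply: eq_bigr => w _; rewrite indicT mulr1.
have hm (w : N.-tuple S) : true ->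
    mixture (@mu_draw R S n N w) (pisnorm (@mu_draw R S n N w)).
  by move=> _; apply: (mixture_pisnorm s0 n0); exact: (mu_draw_mixture R hnN).
have qk : \sum_w `|q w| * pisnorm (@mu_draw R S n N w) <= kappa_fin R S n N.
  rewrite -[leRHS]mul1r -q1 mulr_suml; apply: ler_sum => w _.
  by rewrite ger0_norm// ler_wpM2l//; exact: (le_bigmax _ _ w).
apply: mixtureW qk _; apply: eq_mixture (mixture_sum q hm) => t.
rewrite (extendible_chi exN ext); last exact: measurable_fdisc_tuple.
under [in RHS]eq_bigr => y _.
  rewrite fdisc_tuple_measureE -EFinM mulr_sumr.
  over.
rewrite sumEFin/= exchange_big/=; apply: eq_bigr => w _.
rewrite (mu_draw_push R hnN) /tensor_push mulr_sumr big_mkcond/=.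
apply: eq_bigr => y _; rewrite indicE.
case: eqP => [e|e]; first by rewrite mem_set// mulr1 mulrC.
by rewrite memNset// !mulr0.
Qed.

End extendible.

Theorem theorem7p10 (R : realType) (n N : nat) (hn : (1 <= n)%N) (hnN : (n <= N)%N) :
  (* (i) arbitrary measurable space S *)
  ((forall (d : measure_display) (S : measurableType d)
      (mu : probability (n.-tuple S) R),
      exchangeable mu -> extendible hnN mu ->
      exists l : {charge set (pprobability S R) -> \bar R},
        represents mu l /\ (tvnorm l <= (kappa R n N)%:E)%E)
   /\
   (exists (d : measure_display) (S : measurableType d)
      (mu : probability (n.-tuple S) R),
      [/\ exchangeable mu, extendible hnN mu &
        forall l : {charge set (pprobability S R) -> \bar R},
          represents mu l -> ((kappa R n N)%:E <= tvnorm l)%E]))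
  /\
  (* (ii) finite S (discrete sigma-algebra), |S| = m *)
  (forall (S : finType) (s0 : S),
     [/\ (forall mu : probability (n.-tuple (fdisc s0)) R,
            exchangeable mu -> extendible hnN mu ->
            exists l : {charge set (pprobability (fdisc s0) R) -> \bar R},
              represents mu l /\ (tvnorm l <= (kappa_fin R S n N)%:E)%E),
         (forall M : R,
            (forall mu : probability (n.-tuple (fdisc s0)) R,
               exchangeable mu -> extendible hnN mu ->
               exists l : {charge set (pprobability (fdisc s0) R) -> \bar R},
                 represents mu l /\ (tvnorm l <= M%:E)%E) ->
            kappa_fin R S n N <= M)
       & ((N <= #|S|)%N -> kappa_fin R S n N = kappa R n N)]).
Proof.
split; [split|].
- move=> d S mu _ [muN [exN ext]].
  apply: (@represents_mixture _ S R n 'I_N (@chi R n N) _ _ _ muN (fun i w => tnth w i)).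
  + by move=> i; exact: measurable_tnth.
  + exact: chi_mixture.
  + exact: extendible_chi.
- have N0 := leq_trans hn hnN.
  (* The extremal law is [chi] itself, seen as the draw from [1, ..., N] on the discrete space
     [N]. *)
  have [mu [ex ext muE]] := mu_draw_law R hnN (Ordinal N0) (ord_tuple N).
  exists _, (fdisc (Ordinal N0)), mu; split => // l rl.
  have mixM M : (tvnorm l <= M%:E)%E -> mixture (@chi R n N) M.
    move=> lM; apply: eq_mixture (represents_lower rl lM) => t.
    rewrite muE/= (mu_draw_push R hnN) /tensor_push (eq_bigl (pred1 t)) ?big_pred1_eq//.
    move=> y /=; congr (_ == _); apply: eq_from_tnth => i.
    by rewrite tnth_map tnth_ord_tuple.
  (* The value [-oo] is excluded because it would give [chi] a mixture bounded by [-1]. *)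
  case lE : (tvnorm l) mixM => [M| |] mixM; rewrite ?leey//.
    by rewrite lee_fin; exact/pisnorm_le/mixM.
  by have /mixture_ge0 := mixM (-1) (leNye _); rewrite oppr_ge0 ler10.
- move=> S s0; split; last exact: kappa_fin_kappa.
  + move=> mu _ ext.
    (* The points are constant, so the probability space is immaterial and a Dirac mass is taken. *)
    apply: (@represents_mixture _ (fdisc s0) R n S
      (fun t : n.-tuple S => fine (mu [set (t : n.-tuple (fdisc s0))])) _ _
      (fdisc s0) (\d_(s0 : fdisc s0)) (fun i _ => (i : fdisc s0))).
    * by move=> i; exact: measurable_cst.
    * exact: extendible_mixture ext.
    * move=> A _; rewrite fdisc_tuple_measureE -sumEFin; apply: eq_bigr => y _.
      rewrite EFinM; congr (_ * _)%E; rewrite -[RHS]/(dirac _ _).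
      rewrite indicE; congr (_ _)%:R%:E.
      by apply/idP/idP; rewrite !inE/= (_ : map_tuple _ _ = y)//; apply: val_inj; rewrite /= map_id.
  + move=> M hM.
    have mixM x : mixture (@mu_draw R S n N x) M.
      have [mu [ex ext muE]] := mu_draw_law R hnN s0 x.
      have [l [rl lM]] := hM mu ex ext.
      by apply: eq_mixture (represents_lower rl lM) => t; rewrite muE.
    (* The maximum in [kappa_fin] starts at 0, so [0 <= M] is also required; a constant tuple
       provides it. *)
    apply/bigmax_leP; split => [|x _]; last exact/pisnorm_le/mixM.
    exact: mixture_ge0 (mixM [tuple s0 | i < N]).
Qed.
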